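(* Let $G$ be a Bayesian network on discrete random variables $X_1,\dots,X_n$ (with arbitrary positive numbers of levels $d_1,\dots,d_n$) whose vertices are labelled so that every directed edge from $X_i$ to $X_j$ satisfies $i>j$. Then the prime ideal $\ker(\Phi)$ is a minimal primary component of both of the ideals $I_{\mathrm{local}(G)}$ and $I_{\mathrm{global}(G)}$. More precisely, $$\bigl(I_{\mathrm{local}(G)}:\mathbf p^\infty\bigr)\;=\;\bigl(I_{\mathrm{global}(G)}:\mathbf p^\infty\bigr)\;=\;\ker(\Phi),$$ where $\mathbf p$ is the product of all linear forms $p_{++\cdots+u_{r+1}\cdots u_n}=\sum_{i_1=1}^{d_1}\cdots\sum_{i_r=1}^{d_r}p_{i_1\cdots i_r u_{r+1}\cdots u_n}$, over all $r\in\{1,\dots,n\}$ and all $u_{r+1}\in[d_{r+1}],\dots,u_n\in[d_n]$.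
   Context: Independence ideals. $X_i$ takes values in $[d_i]=\{1,\dots,d_i\}$ and $D=[d_1]\times\cdots\times[d_n]$. $\mathbb{R}[D]$ is the polynomial ring over $\mathbb{R}$ in the unknowns $p_{u_1\cdots u_n}$, $(u_1,\dots,u_n)\in D$. For pairwise disjoint $A,B,C\subseteq\{X_1,\dots,X_n\}$ and tuples of values $a,b,c$ of the variables in $A,B,C$, let $p_{a,b,c,+}$ be the sum of all $p_u$ over $u\in D$ whose coordinates in $A,B,C$ are $a,b,c$. The ideal $I_{A\perp B\mid C}$ is generated by all $p_{a,b,c,+}\,p_{a',b',c,+}-p_{a,b',c,+}\,p_{a',b,c,+}$ (it is $0$ if $A$ or $B$ is empty). The ideal of a set of statements is the sum of the corresponding ideals. Bayesian networks. A Bayesian network is an acyclic directed graph $G$ with vertices $X_1,\dots,X_n$. Let $\mathrm{pa}(X_i)$ be the set of parents of $X_i$ and $\mathrm{nd}(X_i)$ the set of vertices $X_j\ne X_i$, not parents of $X_i$, such that there is no directed path from $X_i$ to $X_j$. Then $\mathrm{local}(G)=\{X_i\perp\mathrm{nd}(X_i)\mid\mathrm{pa}(X_i): i=1,\dots,n\}$. The set $\mathrm{global}(G)$ consists of all $A\perp B\mid C$ with $A,B,C$ pairwise disjoint such that every chain (path in the underlying undirected graph) from a vertex of $A$ to a vertex of $B$ is blocked by $C$. A chain $\pi$ is blocked by $C$ if it contains a vertex $X_b$ such that either $X_b\in C$ and the arrows of $\pi$ do not meet head-to-head at $X_b$, or $X_b\notin C$, $X_b$ has no descendents in $C$, and the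 arrows of $\pi$ do meet head-to-head at $X_b$. $I_{\mathrm{local}(G)}$ and $I_{\mathrm{global}(G)}$ are the corresponding ideals. Factorization map. For each node $X_j$ with parents $X_{i_1},\dots,X_{i_r}$ introduce unknowns $q^{(j)}_{u_0u_1\cdots u_r}$, $u_0\in[d_j]$, $u_1\in[d_{i_1}],\dots,u_r\in[d_{i_r}]$, subject to $\sum_{v=1}^{d_j}q^{(j)}_{vu_1\cdots u_r}=1$ for all $u_1,\dots,u_r$; let $\mathbb{R}[E]$ be the polynomial ring they generate (there are $(d_j-1)d_{i_1}\cdots d_{i_r}$ free unknowns for node $j$). The ring homomorphism $\Phi:\mathbb{R}[D]\to\mathbb{R}[E]$ sends $p_{u_1\cdots u_n}$ to $\prod_{j=1}^n q^{(j)}_{u_ju_{i_1}\cdots u_{i_r}}$, where in the $j$-th factor $X_{i_1},\dots,X_{i_r}$ are the parents of $X_j$. Here $\ker(\Phi)$ denotes the homogeneous ideal generated by all homogeneous polynomials in $\mathbb{R}[D]$ that $\Phi$ maps to $0$ (equivalently, all homogeneous polynomials vanishing on every probability distribution that factors according to $G$). For an ideal $I$ and polynomial $f$, $(I:f^\infty)=\{g: f^mg\in I\text{ for some }m\}$. ''Minimal primary component'' means an isolated primary component, i.e. one belonging to a minimal prime. *)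

(* Defs.v *)
From HB Require Import structures.
From mathcomp Require Import all_boot all_order all_algebra.
From mathcomp Require Import boolp classical_sets reals.
From mathcomp Require Import mpoly.

Set Implicit Arguments.
Unset Strict Implicit.
Unset Printing Implicit Defensive.

Import Order.TTheory GRing.Theory Num.Theory.

Local Open Scope ring_scope.

Section Ideals.
Variable A : comNzRingType.
Implicit Types I J P : set A.

(* The ideals of ring_quotient are boolean predicates and are proper by
   definition; generated ideals need neither restriction. *)
Definition is_ideal I : Prop :=
  [/\ I 0, (forall f g, I f -> I g -> I (f + g))
    & (forall h f, I f -> I (h * f))].

Definition ideal_gen (S : set A) : set A :=
  fun f => forall I, is_ideal I -> (S `<=` I)%classic -> I f.

Definition prime_ideal P : Prop :=
  [/\ is_ideal P, ~ P 1 & forall f g, P (f * g) -> P f \/ P g].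

Definition radical I : set A := fun f => exists m : nat, I (f ^+ m).

Definition primary_ideal I : Prop :=
  [/\ is_ideal I, ~ I 1 & forall f g, I (f * g) -> I f \/ radical I g].

Definition saturation I (f : A) : set A :=
  fun g => exists m : nat, I (f ^+ m * g).

Definition minimal_prime_over I P : Prop :=
  [/\ prime_ideal P, (I `<=` P)%classic
    & forall P', prime_ideal P' -> (I `<=` P')%classic ->
                 (P' `<=` P)%classic -> P' = P].

Definition minimal_primary_decomposition I (k : nat) (Q : 'I_k -> set A) :
    Prop :=
  [/\ forall i, primary_ideal (Q i),
      forall f, I f <-> (forall i, Q i f),
      forall i, exists f, (forall j, j != i -> Q j f) /\ ~ Q i f
    & injective (fun i => radical (Q i))].

Definition isolated_primary_component I J : Prop :=
  exists (k : nat) (Q : 'I_k -> set A),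
    minimal_primary_decomposition I Q /\
    exists i, Q i = J /\ minimal_prime_over I (radical J).

Lemma ideal_gen_is_ideal (S : set A) : is_ideal (ideal_gen S).
Proof.
split=> [I [] // | f g Sf Sg I idI SI | h f Sf I idI SI]; case: (idI) => _ D M.
- by apply: D; [apply: Sf | apply: Sg].
- by apply: M; apply: Sf.
Qed.

Lemma sub_ideal_gen (S : set A) : (S `<=` ideal_gen S)%classic.
Proof. by move=> f Sf I _; apply. Qed.

End Ideals.

Section Graphs.
Variable n : nat.

(* The vertex X_(i+1) is encoded by i : 'I_n, and [arrow i j] is i -> j. *)
Record bayes_net := BayesNet {
  arrow :> rel 'I_n;
  arrow_acyclic : forall c : seq 'I_n, c != [::] -> ~~ cycle arrow c
}.

(* Conditional independence statement: ci_l _||_ ci_r given ci_c. *)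
Record ci_statement := CIStatement {
  ci_l : {set 'I_n};
  ci_r : {set 'I_n};
  ci_c : {set 'I_n}
}.

Variable G : bayes_net.

Definition pa (i : 'I_n) : {set 'I_n} := [set j | G j i]%SET.

(* There is a directed path with at least one arrow from i to j. *)
Definition descendent (i j : 'I_n) : bool :=
  [exists k, G i k && connect G k j].

Definition nd (i : 'I_n) : {set 'I_n} :=
  [set j | [&& j != i, j \notin pa i & ~~ descendent i j]]%SET.

Definition local_markov : set ci_statement :=
  fun s => exists i : 'I_n, s = CIStatement [set i]%SET (nd i) (pa i).

Definition chain (s : seq 'I_n) : bool :=
  uniq s && sorted (fun i j => G i j || G j i) s.

(* The arrows of the chain s meet head-to-head at its vertex b, which is then
   necessarily an inner vertex of s. *)
Definition head_to_head (s : seq 'I_n) (b : 'I_n) : Prop :=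
  exists s1 s2 x y, s = s1 ++ [:: x, b, y & s2] /\ G x b /\ G y b.

Definition blocked (C : {set 'I_n}) (s : seq 'I_n) : Prop :=
  exists2 b, b \in s &
    (b \in C /\ ~ head_to_head s b) \/
    [/\ b \notin C, forall c, c \in C -> ~~ descendent b c
      & head_to_head s b].

Definition global_markov : set ci_statement :=
  fun s => let: CIStatement A B C := s in
    [/\ [disjoint A & B], [disjoint A & C], [disjoint B & C]
      & forall (x : 'I_n) (p : seq 'I_n), chain (x :: p) ->
          x \in A -> last x p \in B -> blocked C (x :: p)].

End Graphs.

Section IndependenceIdeals.
Variables (R : realType) (n : nat) (d : 'I_n -> nat).

(* The level set [d_i] = {1, ..., d_i} is encoded by 'I_(d i). *)
Definition config (S : {set 'I_n}) : finType :=
  {dffun forall i : {i : 'I_n | i \in S}, 'I_(d (val i))}.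

Definition state : finType := {dffun forall i : 'I_n, 'I_(d i)}.

Definition restr (S : {set 'I_n}) (u : state) : config S :=
  finfun (fun i : {i : 'I_n | i \in S} => u (val i)).

(* R[D]: the unknowns are numbered through the enumeration of D. *)
Definition RD := {mpoly R[#|state|]}.

Definition p_ (u : state) : RD := 'X_(enum_rank u).

(* p_{a,b,c,+} *)
Definition marg3 (A B C : {set 'I_n})
    (a : config A) (b : config B) (c : config C) : RD :=
  \sum_(u : state | [&& restr A u == a, restr B u == b & restr C u == c]) p_ u.

(* The generators all vanish when A or B is empty, since config set0 is a
   singleton. *)
Definition ci_ideal (s : ci_statement n) : set RD :=
  let: CIStatement A B C := s in
  ideal_gen (fun f => exists (a a' : config A) (b b' : config B)
    (c : config C),
    f = marg3 a b c * marg3 a' b' c - marg3 a b' c * marg3 a' b c).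

(* The sum of the ideals of the statements in M. *)
Definition ci_set_ideal (M : set (ci_statement n)) : set RD :=
  ideal_gen (fun f => exists2 s, M s & ci_ideal s f).

(* For u ranging over the tails (u_{r+1}, ..., u_n), which have the 0-based
   positions r, ..., n-1, this is the linear form p_{+...+u_{r+1}...u_n}. *)
Definition tail (r : nat) : {set 'I_n} := [set i : 'I_n | (r <= i)%N]%SET.

Definition tail_form (r : nat) (w : config (tail r)) : RD :=
  \sum_(u : state | restr (tail r) u == w) p_ u.

Definition p_prod : RD :=
  \prod_(1 <= r < n.+1) \prod_(w : config (tail r)) tail_form w.

Variable G : bayes_net n.

(* Free unknowns of R[E]: a node j, one of its first d_j - 1 levels, and the
   levels of its parents. *)
Definition param : finType :=
  {j : 'I_n & ('I_(d j).-1 * config (pa G j))%type}.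

Definition RE := {mpoly R[#|param|]}.

Definition q_free (j : 'I_n) (v : 'I_(d j).-1) (w : config (pa G j)) : RE :=
  'X_(enum_rank (Tagged (fun j => ('I_(d j).-1 * config (pa G j))%type) (v, w))).

(* The unknown of the last level is eliminated by the relation [sum_q]. *)
Definition q_ (j : 'I_n) (v : 'I_(d j)) (w : config (pa G j)) : RE :=
  if insub (val v) is Some v' then q_free v' w
  else 1 - \sum_(v' < (d j).-1) q_free v' w.

Lemma sum_q (j : 'I_n) (w : config (pa G j)) :
  (0 < d j)%N -> \sum_(v < d j) q_ v w = 1.
Proof.
rewrite /q_; case: (d j) (q_free (j := j)) => // m q _; rewrite big_ord_recr /=.
rewrite insubF ?ltnn // addrC -[RHS](subrK (\sum_(i < m) q i w)).
congr (_ + _); apply: eq_bigr => i _.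
by rewrite (insubT (fun k => (k < m)%N) (ltn_ord i)); congr (q _ w); exact: val_inj.
Qed.

Definition Phi : RD -> RE :=
  mmap (@mpolyC _ R)
    (fun k => let u : state := enum_val k in
              \prod_(j < n) q_ (u j) (restr (pa G j) u)).

Lemma Phi_p (u : state) : Phi (p_ u) = \prod_(j < n) q_ (u j) (restr (pa G j) u).
Proof. by rewrite /Phi /p_ mmapX mmap1U enum_rankK. Qed.

(* Phi is not graded: ker Phi denotes the homogeneous ideal generated by the
   homogeneous polynomials that Phi annihilates. *)
Definition ker_Phi : set RD :=
  ideal_gen (fun f => (exists k : nat, f \is k.-homog) /\ Phi f = 0).

End IndependenceIdeals.

(* Main.v *)
Require Import Defs.
From HB Require Import structures.
From mathcomp Require Import all_boot all_order all_algebra.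
From mathcomp Require Import boolp classical_sets reals.
From mathcomp Require Import fraction mpoly.

(** Write [p] for the product of the linear forms and [t_r(u)] for the form
    [p_{+...+ u_{r+1} ... u_n}], so that [t_0(u) = p_u] and [t_n(u)] is the sum
    of all unknowns.  The three ideals are compared through the chain
      [(I_local : p^oo) <= (I_global : p^oo) <= ker Phi <= (I_local : p^oo)].

    The first inclusion holds because every local Markov statement is a global
    one ([local_sub_global]).  For the second, [ker Phi] is prime, being the
    kernel of [p_u |-> X * Phi(p_u)] with an extra variable [X] that records
    degrees ([ker_PhiE]); it does not contain [p], since at the uniform
    distribution every linear form is positive ([p_prod_notin_ker]); and it
    contains [I_global], which is the soundness of d-separation
    ([global_sub_ker]).  Soundness is proved by summing out the vertices from
    which no directed path, even a trivial one, leads into [A], [B] or [C];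
    after this a set [U] that contains [B] and is disjoint from [A] splits the
    remaining factors into those that see, outside [C], only vertices of [U]
    and those that see none ([separating_set]); exchanging the coordinates in
    [U] between two states then turns one product of the defining binomial into
    the other ([global_independence]).

    The third inclusion is the chain rule.  Modulo [I_local] the local Markov
    statement of the vertex [j] says that the ratio [t_j(u) / t_{j+1}(u)]
    depends only on the coordinates of [u] at [j] and at its parents
    ([tail_sum_markov]).  Choose for every [j] a state [e_j] with the same
    coordinates as [u] there; telescoping gives
      [t_n * prod_j (t_j(e_j) / t_{j+1}(e_j)) = p_u]
    once the denominators, all of them factors of [p], are inverted
    ([chain_rule]).  The factors on the left form a table of conditional
    probabilities, so a homogeneous [f] killed by [Phi] vanishes when each
    [p_u] is replaced by their product ([homogeneous_vanish]); hence [f] itself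
    lies in [(I_local : p^oo)] ([ker_sub_saturation]).

    Finally, if a prime [P] not containing [f] equals [(I : f^oo)], then [P]
    is an isolated component of every minimal primary decomposition of [I]
    ([isolated_of_saturation]); that such a decomposition exists is the
    Lasker-Noether theorem, deduced here from Hilbert's basis theorem. *)

Set Implicit Arguments.
Unset Strict Implicit.
Unset Printing Implicit Defensive.

(** * Ideals, Noetherian rings and primary decompositions *)

Section IdealTheory.
Local Open Scope ring_scope.
Import GRing.Theory.
Context {A : comNzRingType}.
Implicit Types I J P Q : set A.

Lemma ideal_zero I : is_ideal I -> I 0. Proof. by case. Qed.
Lemma ideal_add I f g : is_ideal I -> I f -> I g -> I (f + g).
Proof. by case=> _ + _; apply. Qed.
Lemma ideal_mull I h f : is_ideal I -> I f -> I (h * f).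
Proof. by case=> _ _; apply. Qed.
Lemma ideal_mulr I h f : is_ideal I -> I f -> I (f * h).
Proof. by rewrite mulrC; apply: ideal_mull. Qed.
Lemma ideal_opp I f : is_ideal I -> I f -> I (- f).
Proof. by rewrite -mulN1r; apply: ideal_mull. Qed.
Lemma ideal_sub I f g : is_ideal I -> I f -> I g -> I (f - g).
Proof. by move=> idI If Ig; apply: ideal_add => //; apply: ideal_opp. Qed.
Lemma ideal_sum I (T : Type) (r : seq T) (Q : pred T) (F : T -> A) :
  is_ideal I -> (forall i, Q i -> I (F i)) -> I (\sum_(i <- r | Q i) F i).
Proof.
by move=> idI IF; elim/big_ind: _ => //; [case: idI | move=> f g; apply: ideal_add].
Qed.
Lemma ideal_prod_congr I (J : finType) (x y : J -> A) :
  is_ideal I -> (forall i, I (x i - y i)) -> I (\prod_i x i - \prod_i y i).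
Proof.
move=> idI xy; elim/big_ind2: _ => [|y1 x1 y2 x2 I1 I2|//].
  by rewrite subrr; apply: ideal_zero.
have -> : x1 * x2 - y1 * y2 = (x1 - y1) * x2 + y1 * (x2 - y2).
  by rewrite mulrBl mulrBr addrA subrK.
by apply: ideal_add => //; [apply: ideal_mulr | apply: ideal_mull].
Qed.

Lemma ideal_exp_le I f m k : is_ideal I -> (m <= k)%N -> I (f ^+ m) -> I (f ^+ k).
Proof. by move=> idI /subnK <- If; rewrite exprD; apply: ideal_mull. Qed.

Lemma ideal_gen_min (S I : set A) :
  is_ideal I -> (S `<=` I)%classic -> (ideal_gen S `<=` I)%classic.
Proof. by move=> idI SI f; apply. Qed.

Lemma ideal_genS (S S' : set A) :
  (S `<=` S')%classic -> (ideal_gen S `<=` ideal_gen S')%classic.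
Proof.
move=> SS'; apply: ideal_gen_min; first exact: ideal_gen_is_ideal.
by move=> f /SS'; apply: sub_ideal_gen.
Qed.

Lemma saturation_is_ideal I f : is_ideal I -> is_ideal (saturation I f).
Proof.
move=> idI; split=> [|g h [m Ig] [k Ih]|h g [m Ig]].
- by exists 0%N; rewrite mulr0; apply: ideal_zero.
- exists (m + k)%N; rewrite mulrDr exprD; apply: ideal_add => //.
    by rewrite (mulrC (f ^+ m)) -mulrA; apply: ideal_mull.
  by rewrite -mulrA; apply: ideal_mull.
- by exists m; rewrite mulrCA; apply: ideal_mull.
Qed.

Lemma saturationS I J f :
  (I `<=` J)%classic -> (saturation I f `<=` saturation J f)%classic.
Proof. by move=> IJ g [m /IJ]; exists m. Qed.

Lemma prime_ideal_exp P f m : prime_ideal P -> P (f ^+ m) -> P f.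
Proof.
case=> idP P1 PM; elim: m => [|m IHm]; first by rewrite expr0 => /P1.
by rewrite exprS => /PM[].
Qed.

Lemma saturation_sub_prime I P f :
  prime_ideal P -> (I `<=` P)%classic -> ~ P f -> (saturation I f `<=` P)%classic.
Proof.
move=> prP IP Pf g [m /IP]; case: (prP) => _ _ PM /PM[] //.
by move/(prime_ideal_exp prP).
Qed.

Lemma radical_prime P : prime_ideal P -> radical P = P.
Proof.
move=> prP; apply/seteqP; split=> f; first by case=> m /(prime_ideal_exp prP).
by exists 1%N.
Qed.

Lemma radical_setI I J : is_ideal I -> is_ideal J ->
  radical (I `&` J)%classic = (radical I `&` radical J)%classic.
Proof.
move=> idI idJ; apply/seteqP; split=> f; first by case=> m [If Jf]; split; exists m.
case=> -[m If] [k Jf]; exists (maxn m k); split.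
  by apply: ideal_exp_le If; rewrite ?leq_maxl.
by apply: ideal_exp_le Jf; rewrite ?leq_maxr.
Qed.

Lemma setI_is_ideal I J : is_ideal I -> is_ideal J -> is_ideal (I `&` J)%classic.
Proof.
move=> idI idJ; split=> [|f g [? ?] [? ?]|h f [? ?]].
- by split; apply: ideal_zero.
- by split; apply: ideal_add.
- by split; apply: ideal_mull.
Qed.

(** What allows two components with a common radical to be merged: for [g]
    outside that radical, each of the two ideals separately contains [f]. *)
Lemma primary_setI Q (Q' : set A) : primary_ideal Q -> primary_ideal Q' ->
  radical Q = radical Q' -> primary_ideal (Q `&` Q')%classic.
Proof.
case=> idQ Q1 QM [idQ' Q1' QM'] eqr; split; first exact: setI_is_ideal.
  by case.
move=> f g [Qfg Q'fg]; rewrite radical_setI //.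
have [rg|rg] := pselect (radical Q g); first by right; split; rewrite -?eqr.
left; split; first by case: (QM _ _ Qfg).
by case: (QM' _ _ Q'fg) => //; rewrite -eqr.
Qed.

End IdealTheory.

Section Noetherian.
Local Open Scope ring_scope.
Import GRing.Theory.

(** Stated by ascending chains, since both the proof for polynomials and the
    induction behind primary decompositions consume it in that form. *)
Definition noetherian (A : comNzRingType) : Prop :=
  forall I : nat -> set A, (forall m, is_ideal (I m)) ->
    (forall m, (I m `<=` I m.+1)%classic) ->
    exists N, forall m, (N <= m)%N -> I m = I N.

Lemma chain_homo (T : Type) (I : nat -> set T) :
  (forall m, (I m `<=` I m.+1)%classic) ->
  forall m k, (m <= k)%N -> (I m `<=` I k)%classic.
Proof.
move=> inc m k /subnKC <-; elim: (k - m)%N => [|l IHl]; first by rewrite addn0.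
by rewrite addnS => f /IHl /inc.
Qed.

Lemma noetherian_field (F : fieldType) : noetherian F.
Proof.
move=> I idI inc.
have [[N [x INx x0]]|nz] := pselect (exists N, exists2 x, I N x & x != 0).
  have full m : (N <= m)%N -> I m = setT.
    move=> /(chain_homo inc) Nm; apply/seteqP; split=> // y _.
    by rewrite -[y](divfK x0); apply: ideal_mull => //; apply: Nm.
  by exists N => m /full ->; rewrite full.
have I0 m : I m = [set 0]%classic.
  apply/seteqP; split=> [x Ix|x ->]; last exact: ideal_zero.
  by apply: contrapT => /eqP x0; apply: nz; exists m, x.
by exists 0%N => m _; rewrite !I0.
Qed.

Lemma noetherian_surj (A B : comNzRingType) (f : {rmorphism A -> B}) :
  (forall y, exists x, f x = y) -> noetherian A -> noetherian B.
Proof.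
move=> fsurj nA I idI inc.
have [|m f0 /inc //|N NI] := nA (fun m => f @^-1` I m)%classic.
  move=> m; split=> /= [|x y|h x]; rewrite /preimage /=.
  - by rewrite rmorph0; apply: ideal_zero.
  - by rewrite rmorphD; apply: ideal_add.
  - by rewrite rmorphM; apply: ideal_mull.
exists N => m /NI E; apply/seteqP; split=> y; have [x <-] := fsurj y.
  by rewrite -[I m _]/((f @^-1` I m)%classic x) E.
by rewrite -[I N _]/((f @^-1` I N)%classic x) -E.
Qed.

Section HilbertBasis.
Variable A : comNzRingType.
Implicit Types I J : set {poly A}.

(** The bound on the size is not an equality, so that [f`_k] may vanish: this
    is what makes the set of leading coefficients closed under addition. *)
Definition lead_ideal I (k : nat) : set A :=
  fun a => exists f, [/\ I f, (size f <= k.+1)%N & f`_k = a].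

Lemma lead_ideal_is_ideal I k : is_ideal I -> is_ideal (lead_ideal I k).
Proof.
move=> idI; split=> [|_ _ [f [If sf <-]] [g [Ig sg <-]]|h _ [f [If sf <-]]].
- by exists 0; rewrite size_poly0 coef0; split=> //; apply: ideal_zero.
- exists (f + g); rewrite coefD; split=> //; first exact: ideal_add.
  by rewrite (leq_trans (size_polyD _ _)) // geq_max sf sg.
- exists (h%:P * f); rewrite mul_polyC coefZ; split=> //.
    by rewrite -mul_polyC; apply: ideal_mull.
  exact: leq_trans (size_scale_leq _ _) sf.
Qed.

Lemma lead_idealS I J m k : is_ideal J -> (I `<=` J)%classic -> (m <= k)%N ->
  (lead_ideal I m `<=` lead_ideal J k)%classic.
Proof.
move=> idJ IJ mk _ [f [/IJ Jf sf <-]]; exists ('X^(k - m) * f); split.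
- exact: ideal_mull.
- apply: leq_trans (size_polyMleq _ _) _.
  by rewrite size_polyXn addSn /= -{2}(subnK mk) -addnS leq_add2l.
- by rewrite coefXnM ltnNge leq_subr /= subKn.
Qed.

(** Cancel the leading term of an element of [J] by an element of [I], and
    recurse on the degree. *)
Lemma lead_ideal_inj I J : is_ideal I -> is_ideal J -> (I `<=` J)%classic ->
  (forall k, (lead_ideal J k `<=` lead_ideal I k)%classic) -> I = J.
Proof.
move=> idI idJ IJ leadJI; apply/seteqP; split=> // f.
move: {2}(size f) (leqnn (size f)) => k; elim: k f => [|k IHk] f.
  by rewrite leqn0 size_poly_eq0 => /eqP -> _; apply: ideal_zero.
move=> sf Jf; have [|g [Ig sg gk]] := leadJI k f`_k; first by exists f.
rewrite -(subrK g f); apply: ideal_add => //; apply: IHk; last first.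
  by apply: ideal_sub => //; apply: IJ.
apply/leq_sizeP => j; rewrite leq_eqVlt => /predU1P[<-|kj].
  by rewrite coefB gk subrr.
rewrite coefB !nth_default ?subr0 //; exact: leq_trans kj.
Qed.

Lemma eventually_constant_uniform (T : Type) (L : nat -> nat -> T) K :
  (forall k, exists N, forall m, (N <= m)%N -> L m k = L N k) ->
  exists N, forall k m, (k < K)%N -> (N <= m)%N -> L m k = L N k.
Proof.
move=> st; elim: K => [|K [N NL]]; first by exists 0%N.
have [M ML] := st K; exists (maxn N M) => k m; rewrite ltnS geq_max.
rewrite leq_eqVlt => /predU1P[->|kK] /andP[Nm Mm].
  by rewrite ML // [RHS]ML ?leq_maxr.
by rewrite NL // [RHS]NL ?leq_maxl.
Qed.

(** The diagonal of the array of leading ideals [L m k] stabilizes at some [K],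
    which makes the array constant on [m, k >= K]; the columns [k < K] are
    finitely many chains, so that they stabilize at a common index. *)
Lemma hilbert_basis : noetherian A -> noetherian {poly A}.
Proof.
move=> nA I idI inc; pose L m k := lead_ideal (I m) k.
have idL m k : is_ideal (L m k) by apply: lead_ideal_is_ideal.
have LS m k m' k' : (m <= m')%N -> (k <= k')%N -> (L m k `<=` L m' k')%classic.
  by move=> mm kk; apply: lead_idealS => //; apply: chain_homo.
have [|m|K KL] := nA (fun m => L m m); [by move=> m | exact: LS |].
have Lcol m k : (K <= m)%N -> (K <= k)%N -> L m k = L K K.
  move=> Km Kk; apply/seteqP; split; last exact: LS.
  by rewrite -(KL (maxn m k)) ?leq_max ?Km //; apply: LS; rewrite ?leq_maxl ?leq_maxr.
have [k|N NL] := @eventually_constant_uniform _ L K.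
  by apply: nA => // m; apply: LS.
exists (maxn K N) => m; rewrite geq_max => /andP[Km Nm].
apply/esym/lead_ideal_inj => //.
  by apply: chain_homo => //; rewrite geq_max Km.
move=> k; rewrite -/(L _ _) -/(L _ _).
have [kK|Kk] := ltnP k K; last by rewrite !Lcol ?leq_maxl.
by rewrite NL // [L (maxn _ _) k]NL ?leq_maxr.
Qed.

End HilbertBasis.

(** Induction on the number of variables: evaluation of the polynomial variable
    at the last indeterminate maps [{poly {mpoly F[n]}}] onto [{mpoly F[n.+1]}]. *)
Lemma noetherian_mpoly (F : fieldType) n : noetherian {mpoly F[n]}.
Proof.
elim: n => [|n IHn].
  apply: (@noetherian_surj _ _ (@mpolyC 0 F)); last exact: noetherian_field.
  move=> p; exists p@_0%MM; apply/mpolyP=> m.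
  rewrite mcoeffC (_ : m = 0%MM) ?eqxx ?mulr1 //.
  by apply/mnmP; case.
pose f : {poly {mpoly F[n]}} -> {mpoly F[n.+1]} :=
  fun p => (map_poly (@mwiden n F) p).['X_ord_max].
have fD : zmod_morphism f by move=> p q; rewrite /f rmorphB hornerD hornerN.
have fM : monoid_morphism f.
  by split=> [|p q]; rewrite /f ?rmorph1 ?hornerC // rmorphM hornerM.
pose fr : {rmorphism {poly {mpoly F[n]}} -> {mpoly F[n.+1]}} :=
  HB.pack f (GRing.isZmodMorphism.Build _ _ f fD)
    (GRing.isMonoidMorphism.Build _ _ f fM).
apply: (@noetherian_surj _ _ fr); last exact: hilbert_basis.
have fC c : fr c%:MP%:P = c%:MP by rewrite /= /f map_polyC hornerC /= mwidenC.
have fX i : exists p, fr p = 'X_i.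
  case: (unliftP ord_max i) => [j|] ->; last first.
    by exists 'X; rewrite /= /f map_polyX hornerX.
  exists ('X_j)%:P; rewrite /= /f map_polyC hornerC /= mwidenX mnmwiden1.
  by congr 'X_[U_(_)]; apply: val_inj; rewrite /= /bump leqNgt ltn_ord.
move=> p; elim/mpolyind: p => [|c m p _ _ [q fq]]; first by exists 0; rewrite rmorph0.
suff [r fr'] : exists r, fr r = 'X_[m].
  exists (c%:MP%:P * r + q); rewrite rmorphD rmorphM fq fr'.
  by rewrite fC mul_mpolyC.
rewrite mpolyXE_id; elim/big_ind: _ => [|x y [a <-] [b <-]|i _].
- by exists 1; rewrite rmorph1.
- by exists (a * b); rewrite rmorphM.
- by have [a <-] := fX i; exists (a ^+ m i); rewrite rmorphXn.
Qed.

End Noetherian.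

Section LaskerNoether.
Local Open Scope ring_scope.
Import GRing.Theory.
Context {A : comNzRingType}.
Hypothesis nA : noetherian A.
Implicit Types I J P Q : set A.

(** Otherwise every counterexample could be enlarged strictly, forever. *)
Lemma noetherian_ind (Pr : set A -> Prop) :
  (forall I, is_ideal I ->
     (forall J, is_ideal J -> (I `<=` J)%classic -> I <> J -> Pr J) -> Pr I) ->
  forall I, is_ideal I -> Pr I.
Proof.
move=> step I0 idI0; apply: contrapT => nP0.
pose bad I := is_ideal I /\ ~ Pr I.
have grow (I : {I | bad I}) :
    {J : {J | bad J} | (sval I `<=` sval J)%classic /\ sval I <> sval J}.
  apply: cid; case: I => I [idI nPI] /=; apply: contrapT => nJ.
  apply: nPI; apply: step => // J idJ IJ neq; apply: contrapT => nPJ.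
  by apply: nJ; exists (exist bad J (conj idJ nPJ)).
pose c m := iter m (fun K : {I | bad I} => sval (grow K)) (exist bad I0 (conj idI0 nP0)).
have [m|m|N NC] := @nA (fun m => sval (c m)).
- by case: (svalP (c m)).
- by case: (svalP (grow (c m))).
have [_] := svalP (grow (c N)); apply; exact/esym/(NC N.+1).
Qed.

Lemma colon_is_ideal I g : is_ideal I -> is_ideal (fun f => I (g * f)).
Proof.
move=> idI; split=> [|f h|h f].
- by rewrite mulr0; apply: ideal_zero.
- by rewrite mulrDr; apply: ideal_add.
- by rewrite mulrCA; apply: ideal_mull.
Qed.

Lemma add_principal_is_ideal I g :
  is_ideal I -> is_ideal (fun f => exists a, I (f - a * g)).
Proof.
move=> idI; split=> [|f h [a If] [b Ih]|h f [a If]].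
- by exists 0; rewrite mul0r subr0; apply: ideal_zero.
- by exists (a + b); rewrite mulrDl opprD addrACA; apply: ideal_add.
- by exists (h * a); rewrite -mulrA -mulrBr; apply: ideal_mull.
Qed.

(** If [f * g] shows that [I] is not primary, the chain of the [I : g^m]
    stabilizes, and for such an [m] the ideal [I] is the intersection of
    [I : g^m], which contains [f], and [I + (g^m)]; both are strictly larger
    than [I]. *)
Lemma primary_decomposition I : is_ideal I ->
  exists k (Q : 'I_k -> set A),
    (forall i, primary_ideal (Q i)) /\ forall f, I f <-> forall i, Q i f.
Proof.
move: I; apply: noetherian_ind => I idI IH.
have [I1|nI1] := pselect (I 1).
  exists 0%N, (fun _ => setT); split=> [[]//|f]; split=> // _.
  by rewrite -[f]mulr1; apply: ideal_mull.
have [prI|nprI] := pselect (primary_ideal I).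
  exists 1%N, (fun _ => I); split=> // f; split=> // If.
  exact: If ord0.
have [f [g [Ifg If rg]]] : exists f g, [/\ I (f * g), ~ I f & ~ radical I g].
  apply: contrapT => nex; apply: nprI; split=> // f g Ifg.
  apply: contrapT => /not_orP[If rg]; apply: nex; by exists f, g.
have [m|m h /=|N NI] := @nA (fun m f => I (g ^+ m * f)).
- exact: colon_is_ideal.
- by rewrite exprS -mulrA; apply: ideal_mull.
pose J1 h := I (g ^+ N.+1 * h).
pose J2 h := exists a, I (h - a * g ^+ N.+1).
have idJ1 : is_ideal J1 by apply: colon_is_ideal.
have idJ2 : is_ideal J2 by apply: add_principal_is_ideal.
have IJ1 : (I `<=` J1)%classic by move=> h; apply: ideal_mull.
have IJ2 : (I `<=` J2)%classic by move=> h Ih; exists 0; rewrite mul0r subr0.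
have nJ1 : I <> J1.
  move=> E; apply: If; rewrite E /J1 exprS mulrAC mulrC (mulrC g); exact: ideal_mull.
have nJ2 : I <> J2.
  move=> E; apply: rg; exists N.+1; rewrite E /J2; exists 1.
  by rewrite mul1r subrr; apply: ideal_zero.
have capJ h : J1 h -> J2 h -> I h.
  move=> J1h [a Ia]; rewrite -(subrK (a * g ^+ N.+1) h); apply: ideal_add => //.
  have : I (g ^+ (N.+1 + N.+1) * a).
    have := ideal_sub idI J1h (ideal_mull (g ^+ N.+1) idI Ia).
    rewrite mulrBr opprB addrC subrK exprD => E.
    by rewrite -mulrA (mulrC _ a).
  have stab m : (N <= m)%N -> I (g ^+ m * a) = I (g ^+ N * a).
    by move/NI/(congr1 (fun S : set A => S a)).
  rewrite stab; last by rewrite (leq_trans (leqnSn N)) ?leq_addr.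
  by rewrite -(stab N.+1) // mulrC.
have [k1 [Q1 [pQ1 E1]]] := IH _ idJ1 IJ1 nJ1.
have [k2 [Q2 [pQ2 E2]]] := IH _ idJ2 IJ2 nJ2.
exists (k1 + k2)%N, (fun i => match split i with inl j => Q1 j | inr j => Q2 j end).
split=> [i|h]; first by case: (split i).
split=> [Ih i|Q].
  by case: (split i) => j; [apply: (E1 h).1 (IJ1 _ Ih) _ | apply: (E2 h).1 (IJ2 _ Ih) _].
apply: capJ; [apply/E1 => i | apply/E2 => i].
  by have := Q (lshift _ i); rewrite -[lshift _ i]/(unsplit (inl i)) unsplitK.
by have := Q (rshift _ i); rewrite -[rshift _ i]/(unsplit (inr i)) unsplitK.
Qed.

(** A decomposition with the least number of components is minimal, since a
    redundant component could be dropped, and two components with the same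
    radical could be replaced by their intersection. *)
Lemma lasker_noether I : is_ideal I ->
  exists k (Q : 'I_k -> set A), minimal_primary_decomposition I Q.
Proof.
move=> idI; pose dec k (Q : 'I_k -> set A) :=
  (forall i, primary_ideal (Q i)) /\ forall f, I f <-> forall i, Q i f.
have exk : exists k, `[< exists Q : 'I_k -> set A, dec k Q >].
  by have [k [Q dQ]] := primary_decomposition idI; exists k; apply/asboolP; exists Q.
case: (ex_minnP exk) => k /asboolP[Q [pQ EQ]] mink; exists k, Q.
have nodec l : (l < k)%N -> forall Q' : 'I_l -> set A, ~ dec l Q'.
  move=> lk Q' dQ'; have /mink : `[< exists Q : 'I_l -> set A, dec l Q >].
    by apply/asboolP; exists Q'.
  by rewrite leqNgt lk.
case: k Q pQ EQ nodec {mink} => [|k] Q pQ EQ nodec; first by split=> // [[]|[]].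
split=> // [i|].
  apply: contrapT => nex; apply: (nodec k (leqnn _) (fun j => Q (lift i j))).
  split=> // f; split=> [/EQ + j|Qf]; first exact.
  have Qf' j : j != i -> Q j f.
    by case: (unliftP i j) => [j' ->|->]; [move=> _; apply: Qf | rewrite eqxx].
  apply/EQ => j; have [->|/Qf' //] := eqVneq j i.
  by apply: contrapT => nQ; apply: nex; exists f.
move=> i j eqr; apply: contrapT => /eqP ij.
case: (unliftP i j) => [j0 defj|E]; last by rewrite E eqxx in ij.
pose Q' l := if l == j0 then (Q i `&` Q j)%classic else Q (lift i l).
apply: (nodec k (leqnn _) Q'); split=> [l|f].
  by rewrite /Q'; case: ifP => // _; apply: primary_setI.
split=> [/EQ Qf l|Q'f].
  by rewrite /Q'; case: ifP => // _; split; apply: Qf.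
have [Qi Qj] : Q i f /\ Q j f by have := Q'f j0; rewrite /Q' eqxx.
apply/EQ => l; case: (unliftP i l) => [l' ->|-> //].
have := Q'f l'; rewrite /Q'; case: eqP => // -> _.
by rewrite -defj.
Qed.

(** Saturating a primary decomposition by [f] erases the components whose
    radical contains [f].  Thus [P] is the intersection of the other ones, hence
    equal to one of them because it is prime.  It is minimal over [I], because
    a prime between [I] and [P] avoids [f] and so contains [I : f^oo]. *)
Lemma isolated_of_saturation I P f :
  is_ideal I -> prime_ideal P -> saturation I f = P -> ~ P f ->
  isolated_primary_component I P.
Proof.
move=> idI prP satI nPf; case: (prP) => idP nP1 PM.
have IP : (I `<=` P)%classic.
  by move=> g Ig; rewrite -satI; exists 0%N; rewrite expr0 mul1r.
have [k [Q dQ]] := lasker_noether idI; exists k, Q; split=> //.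
have [pQ EQ irr injr] := dQ.
have [i QiP nri] : exists2 i, (Q i `<=` P)%classic & ~ radical (Q i) f.
  apply: contrapT => nex.
  (* Otherwise the product of the elements [g i] would lie in [I : f^oo]. *)
  have bad i : exists g, ~ P g /\ saturation (Q i) f g.
    have [[m Qfm]|nrf] := pselect (radical (Q i) f).
      by exists 1; split=> //; exists m; rewrite mulr1.
    have : ~ (Q i `<=` P)%classic by move=> QP; apply: nex; exists i.
    move=> /existsNP[g /not_implyP[Qg nPg]]; exists g; split=> //.
    by exists 0%N; rewrite expr0 mul1r.
  have [g gP] := choice bad.
  have idQ i : is_ideal (Q i) by case: (pQ i).
  suff : P (\prod_i g i).
    apply: (big_ind (fun x => ~ P x)) => // [x y nx ny /PM[]//|i _].
    by case: (gP i).
  rewrite -satI.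
  have [m mP] := choice (fun i => (gP i).2).
  exists (\sum_i m i)%N; apply/EQ => i; rewrite (bigD1 i) //= [X in _ * X](bigD1 i) //=.
  rewrite exprD mulrACA; apply: ideal_mulr => //.
exists i; split.
  apply/seteqP; split=> // g; rewrite -satI => -[m /EQ/(_ i)].
  rewrite mulrC; case: (pQ i) => _ _ QM /QM[//|[l]]; rewrite -exprM => Qf.
  by case: nri; exists (m * l)%N.
rewrite radical_prime //; split=> // P' prP' IP' P'P.
apply/seteqP; split=> // g; rewrite -satI => -[m /IP'].
by case: (prP') => _ _ P'M /P'M[/(prime_ideal_exp prP') /P'P|].
Qed.

End LaskerNoether.

(** * Evaluation of polynomials *)

Section PolynomialMaps.
Local Open Scope ring_scope.
Import GRing.Theory.

Lemma rmorph_mmap (R : nzRingType) (S T : comNzRingType) (g : {rmorphism S -> T})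
    (h : {rmorphism R -> S}) k (v : 'I_k -> S) (f : {mpoly R[k]}) :
  g (mmap h v f) = mmap (g \o h) (g \o v) f.
Proof.
rewrite /mmap rmorph_sum; apply: eq_bigr => m _; rewrite rmorphM /mmap1 rmorph_prod.
by congr (_ * _); apply: eq_bigr => i _; rewrite rmorphXn.
Qed.

Lemma eq_mmap (R : nzRingType) (S : comNzRingType) (h : {rmorphism R -> S}) k
    (v v' : 'I_k -> S) (f : {mpoly R[k]}) :
  v =1 v' -> mmap h v f = mmap h v' f.
Proof.
move=> vv; apply: eq_bigr => m _; congr (_ * _).
by apply: eq_bigr => i _; rewrite vv.
Qed.

(** The use made of homogeneity: the values of the unknowns may be rescaled. *)
Lemma mmap_homogM (R : nzRingType) (S : comNzRingType) (h : {rmorphism R -> S}) k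
    (v : 'I_k -> S) (c : S) e (f : {mpoly R[k]}) :
  f \is e.-homog -> mmap h (fun i => c * v i) f = c ^+ e * mmap h v f.
Proof.
move=> /dhomogP hf; rewrite /mmap big_distrr /= !big_seq; apply: eq_bigr => m /hf.
rewrite -[X in X = _]/(mdeg m) => me.
rewrite mulrCA; congr (_ * _); rewrite /mmap1 -me mdegE -prodrXr -big_split /=.
by apply: eq_bigr => i _; rewrite exprMn.
Qed.

Lemma mmap_ideal_congr (A : nzRingType) (S : comNzRingType) (h : {rmorphism A -> S})
    k (I : set S) (v v' : 'I_k -> S) (f : {mpoly A[k]}) :
  is_ideal I -> (forall i, I (v i - v' i)) -> I (mmap h v f - mmap h v' f).
Proof.
move=> idI vv'; rewrite /mmap -sumrB; apply: ideal_sum => // m _.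
rewrite -mulrBr; apply: ideal_mull => //; apply: ideal_prod_congr => // i.
by rewrite subrXX; apply: ideal_mulr.
Qed.

Lemma big_widen_max (V : nmodType) m (F : 'I_m -> V) (a : 'I_m) :
  (m.-1 <= a)%N -> \sum_i F i = \sum_(i < m.-1) F (widen_ord (leq_pred m) i) + F a.
Proof.
case: m F a => [F []//|m F a am]; rewrite big_ord_recr /=; congr (_ + F _).
  by apply: eq_bigr => i _; congr F; apply: val_inj.
by apply/val_inj/eqP; rewrite eqn_leq am -ltnS ltn_ord.
Qed.

Lemma XnMC_eq0 (A : nzRingType) e (c : A) : 'X^e * c%:P = 0 -> c = 0.
Proof.
move=> /(congr1 (fun p : {poly A} => p`_e)).
by rewrite coefXnM ltnn subnn coefC coef0.
Qed.

Lemma kernel_prime (A : comNzRingType) (B : idomainType) (f : {rmorphism A -> B}) :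
  prime_ideal [set x | f x = 0]%classic.
Proof.
split=> [|/=|x y /= /eqP].
- split=> [|x y /= x0 y0|h x /= x0] /=; first by rewrite rmorph0.
    by rewrite rmorphD x0 y0 addr0.
  by rewrite rmorphM x0 mulr0.
- by rewrite rmorph1 => /eqP; rewrite oner_eq0.
- by rewrite rmorphM mulf_eq0 => /orP[] /eqP; [left|right].
Qed.

End PolynomialMaps.

(** * States and configurations *)

Section States.
Variables (n : nat) (d : 'I_n -> nat).
Implicit Types (S : {set 'I_n}) (u v x : state d).

Lemma eq_restrP S u v :
  reflect (forall i, i \in S -> u i = v i) (restr S u == restr S v).
Proof.
apply: (iffP eqP) => [/ffunP E i iS|E].
  by have := E (exist _ i iS); rewrite !ffunE.
by apply/ffunP => -[i iS]; rewrite !ffunE; apply: E.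
Qed.

(** Configurations are dependent functions on a subset of the vertices; this
    lets them be handled through the states that extend them. *)
Lemma restr_surj u S (w : config d S) : exists v, restr S v = w.
Proof.
exists (finfun (fun i : 'I_n =>
  match boolP (i \in S) with
  | AltTrue iS => w (exist _ i iS)
  | AltFalse _ => u i
  end)).
apply/ffunP => -[i iS]; rewrite !ffunE /=.
by case: {-}_ / boolP => [iS'|];
  [congr (w (exist _ i _)); apply: bool_irrelevance | rewrite iS].
Qed.

Definition mix S u v : state d := finfun (fun i => if i \in S then u i else v i).

Lemma mix_in S u v i : i \in S -> mix S u v i = u i.
Proof. by rewrite ffunE => ->. Qed.

Lemma mix_notin S u v i : i \notin S -> mix S u v i = v i.
Proof. by rewrite ffunE => /negPf ->. Qed.

Lemma base_state : (forall i, 0 < d i) -> state d.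
Proof. by move=> d_pos; exact: (finfun (fun i => Ordinal (d_pos i))). Qed.

End States.

Section Update.
Variables (n : nat) (d : 'I_n -> nat).
Implicit Types (S U : {set 'I_n}) (u v : state d).

Definition update u k (x : 'I_(d k)) : state d := finfun (dfwith u x).

Lemma update_in u k x : @update u k x k = x.
Proof. by rewrite ffunE dfwith_in. Qed.

Lemma update_out u k x j : k != j -> @update u k x j = u j.
Proof. by move=> kj; rewrite ffunE dfwith_out. Qed.

Lemma restr_update S u k (x : 'I_(d k)) : k \notin S -> restr S (update u x) = restr S u.
Proof.
move=> kS; apply/eqP/eq_restrP => i iS; rewrite update_out //.
by apply: contraNneq kS => ->.
Qed.

Lemma update_id u k : update u (u k) = u.
Proof. by apply/ffunP => j; rewrite ffunE; case: dfwithP. Qed.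

Lemma update2 u k (x y : 'I_(d k)) : update (update u x) y = update u y.
Proof.
apply/ffunP => j; have [<-|kj] := eqVneq k j; first by rewrite !update_in.
by rewrite !update_out.
Qed.

Lemma restr_mix_sub S U u v : S \subset U -> restr S (mix U u v) = restr S u.
Proof.
by move=> /fintype.subsetP SU; apply/eqP/eq_restrP => i /SU; apply: mix_in.
Qed.

Lemma restr_mix_disj S U u v : [disjoint S & U] -> restr S (mix U u v) = restr S v.
Proof.
by move=> SU; apply/eqP/eq_restrP => i iS; rewrite mix_notin // (disjointFr SU).
Qed.

Lemma restr_mix_eq S U u v :
  restr S u = restr S v -> restr S (mix U u v) = restr S v.
Proof.
move=> /eqP/eq_restrP E; apply/eqP/eq_restrP => i iS.
by rewrite ffunE; case: ifP => // _; apply: E.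
Qed.

End Update.

(** * The kernel of the factorization map *)

Section Factorization.
Local Open Scope ring_scope.
Import Order.TTheory GRing.Theory Num.Theory.
Variables (R : realType) (n : nat) (d : 'I_n -> nat) (G : bayes_net n).
Hypothesis d_pos : forall i : 'I_n, (0 < d i)%N.

Local Notation RD := (@RD R n d).
Local Notation RE := (@RE R n d G).
Local Notation Phi := (@Phi R n d G).
Local Notation ker_Phi := (@ker_Phi R n d G).
Local Notation p_ := (@p_ R n d).
Local Notation q_ := (@q_ R n d G _).

Definition Phi_var (k : 'I_#|state d|) : RE :=
  \prod_(j < n) q_ (enum_val k j) (restr (pa G j) (enum_val k)).

HB.instance Definition _ := GRing.RMorphism.copy Phi (mmap (@mpolyC _ R) Phi_var).

Definition factor_product (S : comNzRingType)
    (g : forall j, 'I_(d j) -> config d (pa G j) -> S) (k : 'I_#|state d|) : S :=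
  \prod_(j < n) g j (enum_val k j) (restr (pa G j) (enum_val k)).

(** The unknown of the last level is eliminated by the normalization, so any
    table whose columns sum to one is a specialization of [R[E]]. *)
Lemma eval_parameters (S : comNzRingType) (h : {rmorphism R -> S})
    (g : forall j, 'I_(d j) -> config d (pa G j) -> S) :
  (forall j w, \sum_v g j v w = 1) ->
  exists ev : {rmorphism RE -> S}, forall f,
    ev (Phi f) = mmap h (factor_product g) f.
Proof.
move=> sum_g.
pose v (k : 'I_#|param d G|) : S :=
  let t := enum_val k in
  g (tag t) (widen_ord (leq_pred _) (tagged t).1) (tagged t).2.
pose ev : {rmorphism RE -> S} := mmap h v.
have ev_free j (a : 'I_(d j).-1) w :
    ev (q_free R a w) = g j (widen_ord (leq_pred _) a) w.
  by rewrite /ev /= mmapX mmap1U /v enum_rankK.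
have ev_q j (a : 'I_(d j)) w : ev (q_ a w) = g j a w.
  rewrite /Defs.q_; case: insubP => [a' _ aa'|].
    by rewrite ev_free; congr g; apply: val_inj.
  rewrite -leqNgt => a_max; rewrite rmorphB rmorph1 rmorph_sum -(sum_g j w).
  rewrite (big_widen_max _ a_max) addrC.
  by under eq_bigr do rewrite ev_free; rewrite addKr.
exists ev => f; rewrite /Defs.Phi rmorph_mmap.
rewrite (@eq_mmap _ _ _ _ _ (factor_product g)); last first.
  by move=> k /=; rewrite rmorph_prod; apply: eq_bigr => j _.
apply: eq_bigr => m _; congr (_ * _).
by rewrite /= /ev /= mmapC.
Qed.

Lemma eval_factorization (S : comNzRingType) (h : {rmorphism R -> S})
    (g : forall j, 'I_(d j) -> config d (pa G j) -> S) (f : RD) :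
  (forall j w, \sum_v g j v w = 1) -> Phi f = 0 ->
  mmap h (factor_product g) f = 0.
Proof. by move=> /(eval_parameters h)[ev evP] f0; rewrite -evP f0 rmorph0. Qed.

(** The variable ['X] records degrees, so that the different homogeneous parts
    of a polynomial cannot cancel each other. *)
Definition Phi_homog : RD -> {poly RE} :=
  mmap (polyC \o @mpolyC _ R) (fun k => 'X * (Phi_var k)%:P).
HB.instance Definition _ := GRing.RMorphism.copy Phi_homog
  (mmap (polyC \o @mpolyC _ R) (fun k => 'X * (Phi_var k)%:P)).

Lemma Phi_homogE e (f : RD) : f \is e.-homog -> Phi_homog f = 'X^e * (Phi f)%:P.
Proof. by move=> hf; rewrite /Phi_homog (mmap_homogM _ _ _ hf) /= /Defs.Phi rmorph_mmap. Qed.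

Lemma ker_PhiE : ker_Phi = [set f | Phi_homog f = 0]%classic.
Proof.
apply/seteqP; split=> [|f /= f0].
  apply: ideal_gen_min => [|f [[e hf] f0] /=]; last first.
    by rewrite (Phi_homogE hf) f0 rmorph0 mulr0.
  by case: (kernel_prime Phi_homog).
have idK := ideal_gen_is_ideal (fun f : RD => (exists k, f \is k.-homog) /\ Phi f = 0).
rewrite (pihomog_partitionE (leqnn (msize f))).
apply: ideal_sum => // e _; apply: sub_ideal_gen.
split; first by exists e; apply: pihomogP.
have := congr1 (fun p : {poly RE} => p`_e) f0.
rewrite {1}(pihomog_partitionE (leqnn (msize f))) rmorph_sum coef0 coef_sum.
rewrite (bigD1 e) //= (Phi_homogE (pihomogP _ _ _)) coefXnM ltnn subnn coefC eqxx.
rewrite big1 ?addr0 // => e' e'e.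
rewrite (Phi_homogE (pihomogP _ _ _)) coefXnM; case: ltnP => // le.
by rewrite coefC subn_eq0 leqNgt ltn_neqAle le (inj_eq val_inj) e'e.
Qed.

Lemma ker_Phi_prime : prime_ideal ker_Phi.
Proof. by rewrite ker_PhiE; apply: kernel_prime. Qed.

Lemma p_homog (u : state d) : p_ u \is 1.-homog.
Proof. by rewrite dhomogX /= mdeg1. Qed.

(** At the uniform conditional probabilities [1 / d_j] all unknowns are
    positive, and a tail form is a sum of at least one of them. *)
Lemma tail_form_notin_ker r (w : config d (tail n r)) : ~ ker_Phi (tail_form R w).
Proof.
have hom : tail_form R w \is 1.-homog by apply: rpred_sum => u _; apply: p_homog.
rewrite ker_PhiE /= (Phi_homogE hom) => /XnMC_eq0 f0.
pose g j (_ : 'I_(d j)) (_ : config d (pa G j)) : R := (d j)%:R^-1.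
have sum_g j w' : \sum_v g j v w' = 1.
  rewrite sumr_const card_ord -[LHS]mulr_natr mulVf // pnatr_eq0 -lt0n; exact: d_pos.
have /eqP := @eval_factorization _ idfun g _ sum_g f0.
rewrite raddf_sum /=.
under eq_bigr do rewrite mmapX mmap1U.
rewrite psumr_eq0; last by move=> u _; apply: prodr_ge0 => j _; rewrite invr_ge0 ler0n.
have [u uw] := restr_surj (base_state d_pos) w.
move=> /allP/(_ u); rewrite mem_index_enum uw eqxx /= => /(_ isT).
by apply/negP/prodf_neq0 => j _; rewrite invr_eq0 pnatr_eq0 -lt0n d_pos.
Qed.

Lemma p_prod_notin_ker : ~ ker_Phi (@p_prod R n d).
Proof.
case: ker_Phi_prime => _ nP1 PM.
have nPprod: forall (I : Type) (s : seq I) (F : I -> RD),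
    (forall i, ~ ker_Phi (F i)) -> ~ ker_Phi (\prod_(i <- s) F i).
  by move=> I s F nF; elim/big_ind: _ => // x y nx ny /PM[].
by apply: (nPprod) => r; apply: (nPprod) => w; apply: tail_form_notin_ker.
Qed.

End Factorization.

(** * Separation in the graph *)

Section Separation.
Variables (n : nat) (G : bayes_net n).
Hypothesis G_ordered : forall i j : 'I_n, G i j -> j < i.

Lemma arrow_asym i j : G i j -> G j i = false.
Proof. by move=> /G_ordered ji; apply/negP => /G_ordered; rewrite ltnNge ltnW. Qed.

Lemma connect_leq i j : connect G i j -> j <= i.
Proof.
case/connectP => p + ->; elim: p i => //= k p IHp i /andP[/G_ordered ki /IHp].
by move=> /leq_trans; apply; apply: ltnW.
Qed.

Lemma descendent_ltn i j : descendent G i j -> j < i.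
Proof. by case/existsP => k /andP[/G_ordered ki /connect_leq jk]; apply: leq_ltn_trans ki. Qed.

Lemma connect_descendent i j : connect G i j -> i = j \/ descendent G i j.
Proof.
case/connectP => -[|k p] /=; first by left.
move=> /andP[ik kp] ->; right; apply/existsP; exists k; rewrite ik.
by apply/connectP; exists p.
Qed.

Lemma ltn_nd_pa (i j : 'I_n) : j < i -> i \in nd G j :|: pa G j.
Proof.
move=> ji; rewrite !inE.
have -> : (i != j) = true by apply: contraTneq ji => ->; rewrite ltnn.
have -> : descendent G j i = false.
  by apply: contraTF ji => /descendent_ltn ij; rewrite -leqNgt ltnW.
by case: (G i j).
Qed.

Definition adjacent i j := G i j || G j i.

(** A chain that leaves [i] along an arrow and ends at a nondescendent has to
    turn back somewhere; up to its first turning point it is directed, so that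
    this point is a descendent of [i]. *)
Lemma collider_below i x q y : descendent G i x -> G y x ->
  path adjacent x q -> last x q \in nd G i ->
  exists2 b, descendent G i b & head_to_head G (y :: x :: q) b.
Proof.
elim: q x y => [|z q IHq] x y ix yx /=; first by rewrite inE ix !andbF.
case/andP => /orP[xz|zx] zq qnd; last first.
  by exists x => //; exists [::], q, y, z.
have iz : descendent G i z.
  case/existsP: ix => k /andP[ik kx]; apply/existsP; exists k; rewrite ik.
  by apply: connect_trans kx _; apply: connect1.
have [b ib [s1 [s2 [x' [y' [E hb]]]]]] := IHq _ _ iz xz zq qnd.
by exists b => //; exists (y :: s1), s2, x', y'; rewrite E.
Qed.

(** A chain from [i] to a nondescendent starts either with an arrow from a
    parent of [i], which blocks it, or with an arrow from [i]; in that case it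
    is blocked at the collider of [collider_below], whose descendents, like
    itself, are not parents of [i] by acyclicity. *)
Lemma local_sub_global : (local_markov G `<=` global_markov G)%classic.
Proof.
move=> _ [i ->]; split.
- by rewrite disjoints1 inE eqxx.
- by rewrite disjoints1 inE; apply/negP => /G_ordered; rewrite ltnn.
- by rewrite disjoint_sym; apply/pred0P => j /=; rewrite !inE; case: (G j i); rewrite ?andbF.
move=> x0 [|k p] /andP[uniq_p]; first by move=> _ /set1P -> /=; rewrite inE eqxx.
move=> /= /andP[ik kp] /set1P x0i last_nd; subst x0; case/orP: ik => [ik|ki].
  have [|b ib hb] := collider_below _ ik kp last_nd.
    by apply/existsP; exists k; rewrite ik connect0.
  exists b; last first.
    right; split=> // [|c]; rewrite inE.
      by apply/negP => /G_ordered; rewrite ltnNge ltnW // descendent_ltn.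
    move=> /G_ordered ic; apply/negP => /descendent_ltn cb.
    by have := ltn_trans ic (ltn_trans cb (descendent_ltn ib)); rewrite ltnn.
  by case: hb => s1 [s2 [x [y [-> _]]]]; rewrite mem_cat !inE eqxx !orbT.
exists k; first by rewrite !inE eqxx orbT.
left; split; first by rewrite inE.
case=> -[|i' [|k' s1]] [s2 [x [y [/= E [xk yk]]]]].
- by case: E xk => <- _; rewrite arrow_asym.
- by case: E xk => _ <- _ /G_ordered; rewrite ltnn.
- move: uniq_p; case: E => _ _ ->; rewrite /= mem_cat !inE eqxx !orbT /=.
  by rewrite andbF.
Qed.

Section ActiveChains.
Variables A B C : {set 'I_n}.
Hypotheses (disjAC : [disjoint A & C]) (disjBC : [disjoint B & C]).
Hypothesis sep : forall (x : 'I_n) (p : seq 'I_n), chain G (x :: p) ->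
  x \in A -> last x p \in B -> blocked G C (x :: p).

Definition ancestral : {set 'I_n} :=
  [set v | [exists w in A :|: B :|: C, connect G v w]].

(** The negation of the blocking condition at an inner vertex [b] of a chain
    whose neighbours on the chain are [x] and [y]. *)
Definition open_at (x b y : 'I_n) : bool :=
  if G x b && G y b then (b \in C) || [exists c in C, descendent G b c]
  else b \notin C.

Fixpoint open_chain (s : seq 'I_n) : bool :=
  if s is x :: t then
    (if t is b :: y :: _ then open_at x b y else true) && open_chain t
  else true.

Definition active (v : 'I_n) (s : seq 'I_n) : Prop :=
  [/\ chain G (v :: s), open_chain (v :: s) & last v s \in B].

Definition reaches (v : 'I_n) : Prop := exists s, active v s.

Lemma open_chain_catr s t : open_chain (s ++ t) -> open_chain t.
Proof. by elim: s => //= x s IHs /andP[_ /IHs]. Qed.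

Lemma active_suffix v s s1 w s2 :
  active v s -> v :: s = s1 ++ w :: s2 -> active w s2.
Proof.
move=> [/andP[us ss] os ls] E; split.
- apply/andP; split; first by move: us; rewrite E cat_uniq => /and3P[].
  by move: ss; rewrite E => /suffix_sorted; apply; apply: suffix_suffix.
- by move: os; rewrite E => /open_chain_catr.
- by move: ls; rewrite -[last v s]/(last v (v :: s)) E last_cat.
Qed.

(** If [w] already lies on the chain, the chain is cut at [w] instead of being
    prolonged; this is how chains stay simple. *)
Lemma reaches_extend v s w : active v s -> adjacent w v ->
  (if s is u :: _ then open_at w v u else true) -> reaches w.
Proof.
move=> act wv ok; case: (boolP (w \in v :: s)) => [ws|nws].
  have [s1 [s2 E]] : exists s1 s2, v :: s = s1 ++ w :: s2.
    by case: (path.splitP ws)  => s1 s2; exists s1, s2; rewrite cat_rcons.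
  by exists s2; apply: active_suffix act E.
case: act => /andP[us ss] os ls; exists (v :: s); split=> //.
  by rewrite /chain cons_uniq nws us /=; apply/andP; split.
by move: os; rewrite /= => ->; case: (s) ok => // u t ->.
Qed.

Lemma reaches_down v w : v \notin C -> G v w -> reaches v -> reaches w.
Proof.
move=> vC vw [s act]; apply: reaches_extend act _ _; first by rewrite /adjacent vw orbT.
by case: s => // u s; rewrite /open_at (arrow_asym vw).
Qed.

Lemma reaches_path v p : all (fun x => x \notin C) (v :: p) -> path G v p ->
  reaches v -> reaches (last v p).
Proof.
elim: p v => //= w p IHp v /and3P[vC wC pC] /andP[vw wp] /(reaches_down vC vw).
by apply: IHp => //; rewrite /= wC.
Qed.

(** The ends of the chain lie outside [C], so a vertex that blocks it is an
    inner one and contradicts [open_at]. *)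
Lemma not_reaches_source a : a \in A -> ~ reaches a.
Proof.
move=> aA [s [ch os lB]].
have aC : a \notin C by rewrite (disjointFr disjAC aA).
have lC : last a s \notin C by rewrite (disjointFr disjBC lB).
have openP s1 s2 x b y : a :: s = s1 ++ [:: x, b, y & s2] -> open_at x b y.
  by move=> E; move: os; rewrite E => /open_chain_catr /= /andP[].
have [b bs [[bC nhh]|[bC nd [s1 [s2 [x [y [E [xb yb]]]]]]]]] := sep ch aA lB; last first.
  have := openP _ _ _ _ _ E; rewrite /open_at xb yb (negPf bC) /=.
  by case/exists_inP => c /nd /negPf ->.
move: bs; rewrite inE; case/predU1P => [ba|bs]; first by rewrite -ba bC in aC.
case: (path.splitP bs) openP lC nhh => s1 [|y s2].
  by rewrite cats0 last_rcons bC.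
rewrite cat_rcons; case: (lastP s1) => [|s1' x] openP _ nhh.
  have := openP [::] s2 a b y erefl; rewrite /open_at bC /=; case: ifP => // /andP[ab yb _].
  by case: nhh; exists [::], s2, a, y.
have := openP (a :: s1') s2 x b y; rewrite cat_rcons /= => /(_ erefl).
rewrite /open_at bC /=; case: ifP => // /andP[xb yb _].
by case: nhh; exists (a :: s1'), s2, x, y; rewrite cat_rcons.
Qed.

Lemma directed_active v p : all (fun x => x \notin C) (v :: p) -> path G v p ->
  last v p \in B -> active v p.
Proof.
move=> pC vp lB; split=> //; last first.
  elim: p v vp pC {lB} => //= w p IHp v /andP[vw wp] /and3P[vC wC pC].
  apply/andP; split; last by apply: IHp => //; rewrite /= wC.
  case: p wp {IHp pC} => // y p /andP[wy _].
  by rewrite /open_at (arrow_asym wy) andbF.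
apply/andP; split; last first.
  by apply: sub_path vp => x y xy; rewrite xy.
have : sorted (fun i j : 'I_n => j < i) (v :: p).
  by apply: sub_path vp => x y; apply: G_ordered.
apply: sorted_uniq => [x y z yx zy|x]; first exact: ltn_trans zy yx.
exact: ltnn.
Qed.

(** The delicate case is that of a new collider [v] with no descendent in [C].
    As [v] is ancestral, there is a directed path from it to [A] or [B], and
    this path avoids [C].  If it ends in [A], then the given chain can be
    continued to [A], which is impossible; if it ends in [B], it is itself an
    active chain, and [w] can be put in front of it. *)
Lemma reaches_up v w : v \in ancestral -> v \notin C -> G w v -> reaches v -> reaches w.
Proof.
move=> vS vC wv [s act]; case: s act => [|u s] act.
  by apply: reaches_extend act _ _; rewrite /adjacent ?wv.
have adj : adjacent w v by rewrite /adjacent wv.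
case: (boolP (G u v)) => [uv|nuv]; last first.
  by apply: reaches_extend act adj _; rewrite /open_at (negPf nuv) andbF.
case: (boolP [exists c in C, descendent G v c]) => [dC|ndC].
  by apply: reaches_extend act adj _; rewrite /open_at wv uv dC orbT.
have ndCP c : connect G v c -> c \notin C.
  case/connect_descendent => [<- //|vc]; apply: contra ndC => cC.
  by apply/exists_inP; exists c.
move: vS; rewrite inE => /exists_inP[x xABC] /connectP[p vp xE].
have pC : all (fun x => x \notin C) (v :: p).
  apply/allP => y yp; apply: ndCP.
  exact: (path_connect vp).
move: xABC; rewrite !inE => /orP[/orP[xA|xB]|xC].
- case: (not_reaches_source xA); rewrite xE; apply: reaches_path => //.
  by exists (u :: s).
- apply: (@reaches_extend v p) => //; first by apply: directed_active => //; rewrite -xE.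
  case: p vp {pC xE} => // y p /andP[vy _].
  by rewrite /open_at (arrow_asym vy) andbF.
- by have /allP/(_ x) := pC; rewrite xE mem_last -xE xC => /(_ isT).
Qed.

(** For [j] in [C] the chain goes through the open collider [v -> j <- w].  If
    [j] is already on the chain, it is an inner vertex there, hence a collider
    since it lies in [C], and the chain from [j] on can be used. *)
Lemma reaches_spouse j v w : j \in ancestral -> v \notin C -> G v j -> G w j ->
  reaches v -> reaches w.
Proof.
move=> jS vC vj wj rv; case: (boolP (j \in C)) => jC; last first.
  by apply: (reaches_up jS jC wj); apply: reaches_down rv.
suff [t act tj] : exists2 t, active j t & if t is u :: _ then G u j else true.
  apply: reaches_extend act _ _; first by rewrite /adjacent wj.
  by case: t tj => // u t uj; rewrite /open_at wj uj jC.
case: rv => s act; case: (boolP (j \in v :: s)) => [js|njs].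
  move: js; rewrite inE; case/predU1P => [jv|js]; first by rewrite -jv jC in vC.
  case: (path.splitP js) act => s1 s2 act.
  exists s2; first by apply: (active_suffix (s1 := v :: s1) act); rewrite cat_rcons.
  case: s2 act => // u s2; rewrite cat_rcons => -[_ os _].
  case: (lastP s1) os => [|s1' x] os.
    by move: os => /= /andP[]; rewrite /open_at jC; case: ifP => // /andP[].
  move: os; rewrite cat_rcons -cat_cons => /open_chain_catr /= /andP[].
  by rewrite /open_at jC; case: ifP => // /andP[].
case: act => /andP[us ss] os ls; exists (v :: s) => //; split=> //.
  by rewrite /chain cons_uniq njs us /=; apply/andP; split; rewrite ?vj ?orbT.
move: os => /= ->; rewrite andbT; case: (s) => // u t.
by rewrite /open_at (arrow_asym vj).
Qed.

Lemma ancestral_pa j v : j \in ancestral -> v \in pa G j -> v \in ancestral.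
Proof.
rewrite !inE => /exists_inP[x xABC jx] vj; apply/exists_inP; exists x => //.
by apply: connect_trans jx; apply: connect1.
Qed.

Lemma sub_ancestral v : v \in A :|: B :|: C -> v \in ancestral.
Proof. by move=> vABC; rewrite inE; apply/exists_inP; exists v. Qed.

(** [U] consists of the vertices joined to [B] by an active chain.  The last
    property says that [C] separates [U] from the rest of the ancestral set in
    its moral graph: apart from [C], no vertex together with its parents meets
    both sides. *)
Lemma separating_set : exists U : {set 'I_n},
  [/\ [disjoint A & U], B \subset U
    & forall j, j \in ancestral -> forall v w, v \in j |: pa G j -> w \in j |: pa G j ->
        v \notin C -> w \notin C -> v \in U -> w \in U].
Proof.
exists [set v | `[< reaches v >]]%SET; split.
- rewrite disjoint_subset; apply/fintype.subsetP => a aA; rewrite !inE.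
  by apply/asboolP; apply: not_reaches_source.
- apply/fintype.subsetP => b bB; rewrite inE; apply/asboolP; exists [::]; split=> //.
move=> j jS v w; rewrite !inE.
case/predU1P => [-> | vj]; case/predU1P => [-> | wj] vC wC rv //.
- exact: (reaches_up jS vC wj rv).
- exact: (reaches_down vC vj rv).
- exact: (reaches_spouse jS vC vj wj rv).
Qed.

End ActiveChains.
End Separation.

(** * Global Markov statements hold for recursive products *)

Section RecursiveProduct.
Local Open Scope ring_scope.
Import GRing.Theory.
Variables (n : nat) (d : 'I_n -> nat) (G : bayes_net n).
Hypothesis G_ordered : forall i j : 'I_n, G i j -> (j < i)%N.
Variables (K : comNzRingType) (F : 'I_n -> state d -> K).
Hypothesis F_local : forall j u v,
  restr (j |: pa G j) u = restr (j |: pa G j) v -> F j u = F j v.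
Hypothesis F_sum : forall j u, \sum_(x : 'I_(d j)) F j (update u x) = 1.
Variable u0 : state d.
Implicit Types (S W : {set 'I_n}) (Q : pred (state d)).

(* The states with support S: those that equal u0 off S. *)
Definition supported S : pred (state d) := fun u => restr (~: S) u == restr (~: S) u0.

Definition marginal S Q : K := \sum_(u | Q u && supported S u) \prod_(j in S) F j u.

(** In this section [F j u] stands for the conditional probability of the
    coordinate [u j] given the parents of [j].  The other factors do not involve
    the coordinate at a childless vertex [k], so that summing over it leaves the
    sum of [F k], which is one. *)
Lemma marginal_sink S Q k :
  k \in S -> (forall j, j \in S -> k \notin pa G j) ->
  (forall u (x : 'I_(d k)), Q (update u x) = Q u) ->
  marginal S Q = marginal (S :\ k) Q.
Proof.
move=> kS sink Qk; rewrite /marginal.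
have supp_upd u (x : 'I_(d k)) : supported S (update u x) = supported S u.
  by rewrite /supported restr_update // inE kS.
have supp_del u : supported (S :\ k) u = supported S u && (u k == u0 k).
  apply/eq_restrP/andP => [E|[/eq_restrP E /eqP uk] j].
    split; last by apply/eqP/E; rewrite !inE eqxx.
    by apply/eq_restrP => j; rewrite inE => jS; apply: E; rewrite !inE negb_and jS orbT.
  by rewrite !inE negb_and negbK; case/predU1P => [-> //|jS]; apply: E; rewrite inE.
rewrite (partition_big (fun u => update u (u0 k))
  (fun u => Q u && supported (S :\ k) u)) /=; last first.
  by move=> u /andP[Qu Su]; rewrite Qk Qu supp_del supp_upd Su update_in eqxx.
apply: eq_bigr => u /andP[Qu]; rewrite supp_del => /andP[Su /eqP uk].
rewrite (reindex_onto (fun x : 'I_(d k) => update u x) (fun v => v k)) /=; last first.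
  by move=> v /andP[_ /eqP <-]; rewrite update2 update_id.
rewrite (eq_bigl xpredT) => [|x]; last first.
  by rewrite Qk Qu supp_upd Su update2 -uk update_id update_in !eqxx.
under eq_bigr => x _.
  rewrite (finset.big_setD1 k) //= (eq_bigr (fun j => F j u)); last first.
    move=> j; rewrite finset.in_setD1 => /andP[jk jS]; apply: F_local; apply: restr_update.
    by rewrite finset.in_setU1 negb_or eq_sym jk sink.
  over.
by rewrite -big_distrl /= F_sum mul1r.
Qed.

(** Vertices outside [W] are summed out in increasing order: arrows decrease
    the index, so the least remaining one has no child left. *)
Lemma marginal_ancestral W Q :
  (forall j, j \in W -> pa G j \subset W) ->
  (forall k u (x : 'I_(d k)), k \notin W -> Q (update u x) = Q u) ->
  \sum_(u | Q u) \prod_j F j u = marginal W Q.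
Proof.
move=> Wpa QW; pose T m := W :|: [set i : 'I_n | (m <= i)%N]%SET.
have step m : (m < n)%N -> marginal (T m) Q = marginal (T m.+1) Q.
  move=> mn; pose k := Ordinal mn.
  have Tk : T m = k |: T m.+1.
    apply/setP => i; rewrite !inE leq_eqVlt -(inj_eq val_inj) /= eq_sym.
    by case: (_ == _); rewrite ?orbT ?orTb.
  have [kW|kW] := boolP (k \in W).
    rewrite Tk; congr marginal; apply/finset.setUidPr.
    by rewrite finset.sub1set finset.in_setU kW.
  have kT : k \notin T m.+1 by rewrite !inE negb_or kW ltnn.
  rewrite (@marginal_sink (T m) _ k); first by rewrite Tk finset.setU1K.
  - by rewrite Tk finset.setU11.
  - move=> j; rewrite !inE => jT; apply/negP => kj; have jk := G_ordered kj.
    case/orP: jT => [/Wpa/fintype.subsetP/(_ k)|]; last by rewrite leqNgt jk.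
    by rewrite inE (negPf kW) => /(_ kj).
  - by move=> u x; apply: QW.
have stepn m : (m <= n)%N -> marginal (T 0%N) Q = marginal (T m) Q.
  by elim: m => [|m IHm] mn; [by [] | exact: etrans (IHm (ltnW mn)) (step m mn)].
have T0 : T 0%N = [set: _]%SET by apply/setP => i; rewrite !inE orbT.
have Tn : T n = W by apply/setP => i; rewrite !inE leqNgt ltn_ord orbF.
rewrite -Tn -(stepn n) // T0 /marginal; apply: eq_big => [u|u _].
  rewrite (_ : supported _ u) ?andbT //.
  by apply/eq_restrP => i; rewrite !inE.
by apply: eq_bigl => j; rewrite inE.
Qed.

Definition event (A B C : {set 'I_n}) (a : config d A) (b : config d B) (c : config d C)
  : pred (state d) := fun u => [&& restr A u == a, restr B u == b & restr C u == c].

(** Both sides are sums over pairs of states; exchanging the coordinates in the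
    separating set [U] is an involution that maps the pairs of one sum to those
    of the other, and it preserves the product of the factors of every vertex
    because each factor involves, outside [C], only one side of [U]. *)
Lemma global_independence A B C (a a' : config d A) (b b' : config d B) (c : config d C) :
  global_markov G (CIStatement A B C) ->
  let P a b := \sum_(u | event a b c u) \prod_j F j u in
  P a b * P a' b' = P a b' * P a' b.
Proof.
move=> [dAB dAC dBC sep] P.
have [U [dAU BU Ucl]] := separating_set G_ordered dAC dBC sep.
pose S := ancestral G A B C.
have Sout k : k \notin S -> [/\ k \notin A, k \notin B & k \notin C].
  move=> kS; suff: k \notin A :|: B :|: C.
    by rewrite !inE !negb_or => /andP[/andP[-> ->] ->].
  by apply: contra kS; apply: sub_ancestral.
have PE x y : P x y = marginal S (event x y c).
  apply: marginal_ancestral => [j jS|k u z /Sout[kA kB kC]].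
    by apply/fintype.subsetP => v; apply: ancestral_pa.
  by rewrite /event !restr_update.
rewrite !PE /marginal !big_distrlr !pair_big /=.
pose swap (w : state d * state d) := (mix U w.2 w.1, mix U w.1 w.2).
have swapK : involutive swap.
  by move=> [u v]; congr pair; apply/ffunP => i; rewrite !ffunE /=; case: (i \in U).
pose E (x : config d A) (y : config d B) (x' : config d A) (y' : config d B)
    (w : state d * state d) :=
  (event x y c w.1 && supported S w.1) && (event x' y' c w.2 && supported S w.2).
have swapE x y x' y' w : E x y x' y' w -> E x y' x' y (swap w).
  case: w => u v; rewrite /E /event /supported /=.
  move=> /andP[/andP[/and3P[/eqP Au /eqP Bu /eqP Cu] /eqP Su]].
  move=> /andP[/and3P[/eqP Av /eqP Bv /eqP Cv] /eqP Sv].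
  rewrite !(restr_mix_disj _ _ dAU) !(restr_mix_sub _ _ BU).
  have uvC : restr C u = restr C v by rewrite Cu Cv.
  have uvS : restr (~: S) u = restr (~: S) v by rewrite Su Sv.
  rewrite (restr_mix_eq U uvC) (restr_mix_eq U uvS) (restr_mix_eq U (esym uvC)).
  by rewrite (restr_mix_eq U (esym uvS)) Au Bu Cu Su Av Bv Cv Sv !eqxx.
rewrite [RHS](reindex_inj (inv_inj swapK)) /=; apply: eq_big => [w|[u v] /= uvE].
  apply/idP/idP => [/swapE //|/(@swapE _ _ _ _ (swap w))].
  by rewrite swapK.
rewrite -!big_split /=; apply: eq_bigr => j jS.
have agree i : i \in C -> u i = v i.
  move=> iC; case/andP: uvE => /andP[/and3P[_ _ /eqP Cu] _] /andP[/and3P[_ _ /eqP Cv] _].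
  by move: i iC; apply/eq_restrP; rewrite Cu Cv.
pose fam := j |: pa G j.
have [[i [ifam iC iU]]|none] :=
    pselect (exists i, [/\ i \in fam, i \notin C & i \in U]).
  rewrite mulrC; congr (_ * _); apply: F_local; apply/eqP/eq_restrP => l lfam.
    rewrite ffunE; case: ifPn => // lU; case: (boolP (l \in C)) => [/agree //|lC].
    by rewrite (Ucl _ jS _ _ ifam lfam iC lC iU) in lU.
  rewrite ffunE; case: ifPn => // lU; case: (boolP (l \in C)) => [/agree //|lC].
  by rewrite (Ucl _ jS _ _ ifam lfam iC lC iU) in lU.
congr (_ * _); apply: F_local; apply/eqP/eq_restrP => l lfam.
  rewrite ffunE; case: ifPn => // lU; case: (boolP (l \in C)) => [/agree //|lC].
  by case: none; exists l.
rewrite ffunE; case: ifPn => // lU; case: (boolP (l \in C)) => [/agree //|lC].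
by case: none; exists l.
Qed.

End RecursiveProduct.

Section GlobalInKernel.
Local Open Scope ring_scope.
Import GRing.Theory.
Variables (R : realType) (n : nat) (d : 'I_n -> nat) (G : bayes_net n).
Hypothesis d_pos : forall i : 'I_n, (0 < d i)%N.
Hypothesis G_ordered : forall i j : 'I_n, G i j -> (j < i)%N.

Lemma marg3_homog A B C (a : config d A) (b : config d B) (c : config d C) :
  marg3 R a b c \is 1.-homog.
Proof. by apply: rpred_sum => u _; apply: p_homog. Qed.

Lemma Phi_marg3 A B C (a : config d A) (b : config d B) (c : config d C) :
  Phi G (marg3 R a b c)
  = \sum_(u | event a b c u) \prod_j q_ R (u j) (restr (pa G j) u).
Proof. by rewrite rmorph_sum; apply: eq_bigr => u _; apply: Phi_p. Qed.

Lemma global_sub_ker :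
  (@ci_set_ideal R n d (global_markov G) `<=` @ker_Phi R n d G)%classic.
Proof.
have [idK _ _] := ker_Phi_prime R d G.
apply: ideal_gen_min => // f [[A B C] sABC]; apply: ideal_gen_min f => //.
move=> _ [a [a' [b [b' [c ->]]]]]; apply: sub_ideal_gen; split.
  by exists 2%N; apply: rpredB; apply: (dhomogM (d := 1%N) (e := 1%N)); apply: marg3_homog.
rewrite rmorphB !rmorphM /= !Phi_marg3; apply/eqP; rewrite subr_eq0; apply/eqP.
apply: (@global_independence n d G G_ordered _
  (fun j u => q_ R (u j) (restr (pa G j) u)) _ _ (base_state d_pos) A B C) => //.
- move=> j u v E; have uv i : i \in j |: pa G j -> u i = v i.
    by move=> ifam; move/eqP/eq_restrP: E; apply.
  congr (q_ R _ _); first by apply: uv; rewrite finset.setU11.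
  by apply/eqP/eq_restrP => i ij; apply: uv; rewrite finset.setU1r.
- move=> j u; rewrite -[RHS](sum_q R (restr (pa G j) u) (d_pos j)).
  apply: eq_bigr => x _; rewrite update_in restr_update // inE.
  by apply/negP => /G_ordered; rewrite ltnn.
Qed.

End GlobalInKernel.

(** * The chain rule modulo the local Markov statements *)

Section ChainRule.
Local Open Scope ring_scope.
Import GRing.Theory.
Variables (R : realType) (n : nat) (d : 'I_n -> nat) (G : bayes_net n).
Hypothesis d_pos : forall i : 'I_n, (0 < d i)%N.
Hypothesis G_ordered : forall i j : 'I_n, G i j -> (j < i)%N.

Local Notation RD := (@RD R n d).
Local Notation I_local := (@ci_set_ideal R n d (local_markov G)).
Local Notation p_ := (@p_ R n d).
Local Notation p := (@p_prod R n d).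

(** The form [t_r(u)].  It is indexed by states because in the chain rule forms
    for different [r], hence with tails of different types, meet. *)
Definition tail_sum (r : nat) (u : state d) : RD := tail_form R (restr (tail n r) u).

Lemma eq_tail_sum r (u v : state d) :
  (forall i : 'I_n, (r <= i)%N -> u i = v i) -> tail_sum r u = tail_sum r v.
Proof.
by move=> uv; congr tail_form; apply/eqP/eq_restrP => i; rewrite inE; apply: uv.
Qed.

Lemma tail_sum0 u : tail_sum 0 u = p_ u.
Proof.
rewrite /tail_sum /tail_form (eq_bigl (pred1 u)) ?big_pred1_eq // => x /=.
apply/eqP/eqP => [/eqP/eq_restrP E|-> //].
by apply/ffunP => i; apply: E; rewrite inE.
Qed.

Lemma sum_tail_sum (j : 'I_n) u :
  \sum_(x : 'I_(d j)) tail_sum j (update u x) = tail_sum j.+1 u.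
Proof.
rewrite /tail_sum /tail_form [RHS](partition_big (fun y : state d => y j) xpredT) //=.
apply: eq_bigr => x _; apply: eq_bigl => y.
apply/eq_restrP/andP => [E|[/eq_restrP E /eqP yj] i].
  split; last by rewrite E ?update_in // inE.
  apply/eq_restrP => i; rewrite inE => ji.
  by rewrite E ?inE ?(ltnW ji) // update_out // neq_ltn ji.
rewrite inE leq_eqVlt => /predU1P[ji|ji].
  by have {ji}<- : j = i by [apply: val_inj]; rewrite yj update_in.
by rewrite E ?inE // update_out // neq_ltn ji.
Qed.

(** The vertices above [j] are parents or nondescendents of [j]; summing the
    generators of the local statement of [j] over the levels of the
    nondescendents below [j] and over one of the two levels of [j] yields this
    relation. *)
Lemma tail_sum_markov (j : 'I_n) u v :
  restr (j |: pa G j) u = restr (j |: pa G j) v ->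
  I_local (tail_sum j u * tail_sum j.+1 v - tail_sum j v * tail_sum j.+1 u).
Proof.
move=> /eqP/eq_restrP uv.
have uvj : restr [set j]%SET u = restr [set j]%SET v.
  by apply/eqP/eq_restrP => i /set1P ->; apply: uv; rewrite finset.setU11.
have uvpa : restr (pa G j) u = restr (pa G j) v.
  by apply/eqP/eq_restrP => i ipa; apply: uv; rewrite finset.setU1r.
pose above (x : state d) (b : config d (nd G j)) :=
  [forall i : {i : 'I_n | i \in nd G j}, (j < val i)%N ==> (b i == x (val i))].
have aboveP (x y : state d) : reflect (forall i, i \in nd G j -> (j < i)%N -> y i = x i)
                          (above x (restr (nd G j) y)).
  apply: (iffP forallP) => [E i ind ji|E [i ind]].
    by have /implyP/(_ ji)/eqP := E (exist _ i ind); rewrite ffunE.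
  by apply/implyP => ji; rewrite ffunE E.
pose M (a : config d [set j]%SET) (b : config d (nd G j)) :=
  marg3 R a b (restr (pa G j) u).
have above_pa (x y : state d) : above x (restr (nd G j) y) ->
    (forall i, i \in pa G j -> y i = x i) -> forall i : 'I_n, (j < i)%N -> y i = x i.
  move=> /aboveP End Epa i ji; have := ltn_nd_pa G_ordered ji.
  by rewrite finset.in_setU => /orP[/End|/Epa]; apply.
have pa_gt i : i \in pa G j -> (j < i)%N by rewrite inE => /G_ordered.
have tail_sumSE x : restr (pa G j) x = restr (pa G j) u ->
    tail_sum j.+1 x = \sum_a \sum_(b | above x b) M a b.
  move=> xu; rewrite /tail_sum /tail_form (partition_big (restr [set j]%SET) xpredT) //=.
  apply: eq_bigr => a _.
  rewrite (partition_big (restr (nd G j)) (above x)) /=; last first.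
    move=> y /andP[/eq_restrP E _]; apply/aboveP => i _ ji; apply: E.
    by rewrite inE.
  apply: eq_bigr => b xb; apply: eq_bigl => y; rewrite -xu.
  apply/andP/and3P => [[/andP[/eq_restrP E ya] yb]|[ya yb /eq_restrP E]]; split=> //.
    by apply/eq_restrP => i /pa_gt ji; apply: E; rewrite inE.
  rewrite ya andbT; apply/eq_restrP => i; rewrite inE; move: i.
  by apply: above_pa => //; rewrite (eqP yb).
have tail_sumE x : restr (pa G j) x = restr (pa G j) u ->
    tail_sum j x = \sum_(b | above x b) M (restr [set j]%SET x) b.
  move=> xu; rewrite /tail_sum /tail_form.
  rewrite (partition_big (restr (nd G j)) (above x)) /=; last first.
    move=> y /eq_restrP E; apply/aboveP => i _ ji; apply: E.
    by rewrite inE ltnW.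
  apply: eq_bigr => b xb; apply: eq_bigl => y; rewrite -xu.
  apply/andP/and3P => [[/eq_restrP E yb]|[ya yb /eq_restrP E]]; split=> //.
  - by apply/eq_restrP => i /set1P ->; apply: E; rewrite inE.
  - by apply/eq_restrP => i /pa_gt ji; apply: E; rewrite inE ltnW.
  apply/eq_restrP => i; rewrite inE leq_eqVlt => /predU1P[ji|].
    have {ji}<- : j = i by apply: val_inj.
    by move/eq_restrP: ya; apply; rewrite finset.set11.
  by move: i; apply: above_pa => //; rewrite (eqP yb).
rewrite tail_sumE // tail_sumSE // tail_sumE // tail_sumSE // -uvj.
have idI : is_ideal I_local by apply: ideal_gen_is_ideal.
rewrite !big_distrl /= [X in _ - X](eq_bigr (fun b' => \sum_a
   \sum_(b | above u b) M (restr [set j]%SET u) b' * M a b)); last first.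
  by move=> b' _; rewrite big_distrr; apply: eq_bigr => a _; rewrite big_distrr.
rewrite [X in X - _](eq_bigr (fun b => \sum_a
   \sum_(b' | above v b') M (restr [set j]%SET u) b * M a b')); last first.
  by move=> b _; rewrite big_distrr; apply: eq_bigr => a _; rewrite big_distrr.
rewrite exchange_big [X in _ - X]exchange_big -sumrB; apply: ideal_sum => // a _.
rewrite [X in _ - X]exchange_big -sumrB; apply: ideal_sum => // b _.
rewrite -sumrB; apply: ideal_sum => // b' _.
apply: sub_ideal_gen; exists (CIStatement [set j]%SET (nd G j) (pa G j)); first by exists j.
by apply: sub_ideal_gen; exists (restr [set j]%SET u), a, b, b', (restr (pa G j) u).
Qed.

Lemma tail_sum_dvd r u : (0 < r <= n)%N -> exists c, tail_sum r u * c = p.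
Proof.
move=> /andP[r0 rn]; rewrite /p_prod (bigD1_seq r) ?iota_uniq //=; last first.
  by rewrite mem_index_iota r0 ltnS.
rewrite (bigD1 (restr (tail n r) u)) //= -/(tail_sum r u) -mulrA; eexists; reflexivity.
Qed.

(** Multiplied by the product of the [t_{j+1}(u)], the difference becomes a
    multiple of
      [prod_j t_j(e j) t_{j+1}(u) - prod_j t_j(u) t_{j+1}(e j)],
    because [p_u * prod_j t_{j+1}(u) = prod_j t_j(u) * t_n(u)].  The factors of
    these two products agree modulo the ideal, vertex by vertex; and the
    multiplier divides a power of [p_prod]. *)
Lemma chain_rule (e : 'I_n -> state d) (c : 'I_n -> RD) u :
  (forall j : 'I_n, restr (j |: pa G j) (e j) = restr (j |: pa G j) u) ->
  (forall j : 'I_n, tail_sum j.+1 (e j) * c j = p) ->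
  saturation I_local p (tail_sum n u * \prod_(j < n) (tail_sum j (e j) * c j) - p ^+ n * p_ u).
Proof.
move=> eu ec; exists n.
have idI : is_ideal I_local by apply: ideal_gen_is_ideal.
have [c' c'P] := choice (fun j : 'I_n => @tail_sum_dvd j.+1 u (ltn_ord j)).
have pE (f : 'I_n -> RD) : (forall j, f j = p) -> p ^+ n = \prod_j f j.
  by move=> fp; rewrite (eq_bigr _ (fun j _ => fp j)) prodr_const card_ord.
rewrite {1}(pE _ c'P) big_split /= -mulrA mulrC -mulrA; apply: (ideal_mull _ idI).
(* Two ways to single out a factor of the product of [t_0(u), ..., t_n(u)]. *)
have tele : \prod_(j < n) tail_sum j u * tail_sum n u = p_ u * \prod_(j < n) tail_sum j.+1 u.
  by rewrite -(big_ord_recr n (fun j : 'I_n.+1 => tail_sum j u)) big_ord_recl tail_sum0.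
have -> : (tail_sum n u * \prod_(j < n) (tail_sum j (e j) * c j) - p ^+ n * p_ u)
    * \prod_(j < n) tail_sum j.+1 u
  = (tail_sum n u * \prod_j c j) *
    (\prod_(j < n) (tail_sum j (e j) * tail_sum j.+1 u)
     - \prod_(j < n) (tail_sum j u * tail_sum j.+1 (e j))).
  rewrite (pE _ ec) mulrBl mulrBr; congr (_ - _).
    by rewrite !big_split /= !mulrA; congr (_ * _); rewrite mulrAC.
  rewrite -(mulrA _ (p_ u)) -tele !big_split /=.
  by rewrite mulrACA mulrC (mulrC (\prod_j c j)) (mulrC (\prod_(j < n) tail_sum j.+1 (e j))).
apply: (ideal_mull _ idI); apply: (ideal_prod_congr idI) => j; apply: tail_sum_markov.
exact: eu.
Qed.

(** Over the field of fractions [a / p] is a table of conditional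
    probabilities; by homogeneity the denominators can be cleared. *)
Lemma homogeneous_vanish (a : forall j, 'I_(d j) -> config d (pa G j) -> RD) e (f : RD) :
  (forall j w, \sum_v a j v w = p) -> f \is e.-homog -> Phi G f = 0 ->
  mmap (@mpolyC _ R) (factor_product a) f = 0.
Proof.
move=> a_sum hf f0; pose F := {fraction {mpoly R[#|state d|]}}.
have p0 : tofrac p != 0.
  rewrite tofrac_eq0; apply/eqP => p0; case: (@p_prod_notin_ker R n d G d_pos).
  by rewrite p0; apply: ideal_zero; apply: ideal_gen_is_ideal.
pose g j v w : F := (tofrac p)^-1 * tofrac (a j v w).
have g_sum j w : \sum_v g j v w = 1.
  by rewrite -big_distrr /= -rmorph_sum a_sum mulVf.
have := eval_factorization (@tofrac _ \o @mpolyC _ R) g_sum f0.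
rewrite (@eq_mmap _ _ _ _ _ (fun k => (tofrac p)^-1 ^+ n * tofrac (factor_product a k))).
  rewrite (mmap_homogM _ _ _ hf) => /eqP.
  rewrite mulf_eq0 !expf_eq0 invr_eq0 (negPf p0) !andbF /= => /eqP E.
  by apply/eqP; rewrite -tofrac_eq0 rmorph_mmap; apply/eqP.
move=> k; rewrite /factor_product big_split /= prodr_const card_ord.
by congr (_ * _); rewrite rmorph_prod.
Qed.

(** For [e_j] take [ext j w], an arbitrary state that extends the configuration
    [w] of the parents of [j], updated at [j].  The cofactor [c] does not depend
    on the level of [j], so that the numerators of a column sum to [p]. *)
Lemma ker_sub_saturation : (@ker_Phi R n d G `<=` saturation I_local p)%classic.
Proof.
have idI : is_ideal I_local by apply: ideal_gen_is_ideal.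
have idJ := saturation_is_ideal p idI.
apply: ideal_gen_min => // f [[e hf] f0].
pose ext j (w : config d (pa G j)) : state d :=
  projT1 (cid (restr_surj (base_state d_pos) w)).
have extP j w : restr (pa G j) (ext j w) = w by rewrite /ext; case: cid.
pose c j w := projT1 (cid (tail_sum_dvd (ext j w) (ltn_ord j : (0 < j.+1 <= n)%N))).
have cP (j : 'I_n) w : tail_sum j.+1 (ext j w) * c j w = p by rewrite /c; case: cid.
pose a (j : 'I_n) (v : 'I_(d j)) w : RD := tail_sum j (update (ext j w) v) * c j w.
have a_sum j w : \sum_v a j v w = p by rewrite -big_distrl /= sum_tail_sum cP.
have N0 := homogeneous_vanish a_sum hf f0.
pose t := tail_form R (restr (tail n n) (base_state d_pos)).
have tE u : tail_sum n u = t by apply: eq_tail_sum => i; rewrite leqNgt ltn_ord.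
have cong (k : 'I_#|state d|) :
    saturation I_local p (t * factor_product a k - p ^+ n * 'X_k).
  have := @chain_rule (fun j => update (ext j (restr (pa G j) (enum_val k))) (enum_val k j))
    (fun j => c j (restr (pa G j) (enum_val k))) (enum_val k).
  rewrite tE /Defs.p_ enum_valK; apply=> j.
    apply/eqP/eq_restrP => i; rewrite finset.in_setU1 => /predU1P[->|ij].
      by rewrite update_in.
    rewrite update_out; last by rewrite neq_ltn; move: ij; rewrite inE => /G_ordered ->.
    by move: i ij; apply/eq_restrP; rewrite extP.
  rewrite -(cP j (restr (pa G j) (enum_val k))); congr (_ * _); apply: eq_tail_sum => i ji.
  by rewrite update_out // neq_ltn ji.
have := mmap_ideal_congr (@mpolyC _ R) f idJ cong.
rewrite !(mmap_homogM _ _ _ hf) N0 mulr0 sub0r => /(ideal_opp idJ); rewrite opprK.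
rewrite -exprM; have -> : mmap (@mpolyC _ R) (fun k => 'X_k) f = f.
  rewrite [RHS]mpolyE; apply: eq_bigr => m _.
  by rewrite mul_mpolyC /mmap1 -mpolyXE_id.
by case=> m; rewrite mulrA -exprD; exists (m + n * e)%N.
Qed.

End ChainRule.

(** * The saturations *)

Lemma ci_set_idealS (R : realType) n (d : 'I_n -> nat) (M M' : set (ci_statement n)) :
  (M `<=` M')%classic -> (@ci_set_ideal R n d M `<=` @ci_set_ideal R n d M')%classic.
Proof. by move=> MM'; apply: ideal_genS => f [s /MM']; exists s. Qed.

Theorem theorem8 (R : realType) (n : nat) (d : 'I_n -> nat) (G : bayes_net n)
    (d_pos : forall i : 'I_n, 0 < d i)
    (G_ordered : forall i j : 'I_n, G i j -> j < i) :
  [/\ prime_ideal (@ker_Phi R n d G),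
      isolated_primary_component
        (@ci_set_ideal R n d (local_markov G)) (@ker_Phi R n d G),
      isolated_primary_component
        (@ci_set_ideal R n d (global_markov G)) (@ker_Phi R n d G),
      saturation (@ci_set_ideal R n d (local_markov G)) (@p_prod R n d)
        = saturation (@ci_set_ideal R n d (global_markov G)) (@p_prod R n d)
    & saturation (@ci_set_ideal R n d (global_markov G)) (@p_prod R n d)
        = @ker_Phi R n d G].
Proof.
have prK := ker_Phi_prime R d G.
have nKp := @p_prod_notin_ker R n d G d_pos.
have loc_glob := @ci_set_idealS R n d _ _ (local_sub_global G_ordered).
have satGK := saturation_sub_prime prK (@global_sub_ker R n d G d_pos G_ordered) nKp.
have satLG := saturationS (f := @p_prod R n d) loc_glob.
have satKL := @ker_sub_saturation R n d G d_pos G_ordered.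
have satG : saturation (@ci_set_ideal R n d (global_markov G)) (@p_prod R n d)
    = @ker_Phi R n d G.
  by apply/seteqP; split=> [//|f /satKL /satLG].
have satL : saturation (@ci_set_ideal R n d (local_markov G)) (@p_prod R n d)
    = @ker_Phi R n d G.
  by apply/seteqP; split=> [f /satLG /satGK|].
have nRD : noetherian (RD R d) by apply: noetherian_mpoly.
split=> //; first 2 last.
- by rewrite satL satG.
- by apply: isolated_of_saturation satL nKp => //; apply: ideal_gen_is_ideal.
- by apply: isolated_of_saturation satG nKp => //; apply: ideal_gen_is_ideal.
Qed.
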